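(* Let $0<T<\infty$ and let $u_0\in\mathcal{P}(\mathbb{R}^d)$ have compact support. Let $u(x,t)=(G_t*u_0)(x)$ and $s=\nabla\log u$ on $\mathbb{R}^d\times(0,T]$. For $x_T\in\mathbb{R}^d$, let $X_t$, $t\in(0,T]$, denote the solution of the ordinary differential equation $$\frac{dX_t}{dt}=-s(X_t,t),\quad t\in(0,T),\qquad X_T=x_T.$$ Then the following statements hold. (i) Let $S=\operatorname{supp}(u_0)$. Then, for Lebesgue-almost every $x_T\in\mathbb{R}^d$, $$\liminf_{t\to0^+}d(X_t,S)=0.$$ (ii) Let $K=\mathrm{conv}(S)$ be the convex hull of $S$. Then, for any $x_T\in\mathbb{R}^d$, $$d(X_t,K)\;\le\;d(x_T,K)\,T^{-1/2}\sqrt{t},\qquad t\in(0,T].$$ (iii) Suppose that $u_0$ is a finite sum of Dirac measures, $u_0=\sum_{k=1}^N w_k\,\delta_{y_k}$, with weights $w_k>0$ and locations $y_k\in\mathbb{R}^d$. Then, for Lebesgue-almost every $x_T\in\mathbb{R}^d$, there exists an index $i\in\{1,\dots,N\}$, depending on $x_T$, such that $$\lim_{t\to0^+}X_t=y_i.$$ Moreover, there exists a constant $C>0$, depending only on $x_T$ and the time horizon $T$, such that $$\|X_t-y_i\|\;\le\;C\sqrt{t},\qquad\forall\,t\in(0,T].$$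
   Context: $\mathcal{P}(\mathbb{R}^d)$ is the set of Borel probability measures on $\mathbb{R}^d$. $G_t(x)=(4\pi t)^{-d/2}\exp(-\|x\|^2/(4t))$ is the heat kernel, and $u(x,t)=\int_{\mathbb{R}^d}G_t(x-y)\,du_0(y)$ solves $\partial_tu-\Delta u=0$, $u(\cdot,0)=u_0$; it is smooth and strictly positive for $t>0$, so the score $s=\nabla\log u=\nabla u/u$ is smooth on $\mathbb{R}^d\times(0,T]$. The ODE is solved backward in time from the datum at time $T$. $d(x,A)=\inf_{y\in A}\|x-y\|$ is the Euclidean distance to a set $A$. The measure $u_0$ is regarded as fixed throughout, so constants may depend on it. *)

(* Defs.v *)
From HB Require Import structures.
From mathcomp Require Import all_boot all_order all_algebra.
From mathcomp Require Import all_classical all_reals all_analysis.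

Set Implicit Arguments.
Unset Strict Implicit.
Unset Printing Implicit Defensive.

Import Order.TTheory GRing.Theory Num.Theory.
Import numFieldNormedType.Exports.

Local Open Scope classical_set_scope.
Local Open Scope ring_scope.

Section tuple_measure_step.
Context {disp} {T : measurableType disp} {R : realType} {n : nat}.
Variable mu : {sigma_finite_measure set T -> \bar R}.
Variable nu : {sigma_finite_measure set (n.-tuple T) -> \bar R}.

Definition cons_pair (p : T * n.-tuple T) : n.+1.-tuple T :=
  [the n.+1.-tuple T of p.1 :: p.2].

Let measurable_cons_pair : measurable_fun setT cons_pair.
Proof. exact: measurable_cons. Qed.

HB.instance Definition _ := isMeasurableFun.Build _ _ _ _ cons_pair
  measurable_cons_pair.

Definition tuple_measure_step : set (n.+1.-tuple T) -> \bar R :=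
  pushforward (mu \x nu)%E cons_pair.

Let tuple_measure_step0 : tuple_measure_step set0 = 0%E.
Proof. exact: measure0. Qed.

Let tuple_measure_step_ge0 A : (0 <= tuple_measure_step A)%E.
Proof. exact: measure_ge0. Qed.

Let tuple_measure_step_sigma_additive : semi_sigma_additive tuple_measure_step.
Proof. exact: measure_semi_sigma_additive. Qed.

HB.instance Definition _ := isMeasure.Build _ _ _ tuple_measure_step
  tuple_measure_step0 tuple_measure_step_ge0 tuple_measure_step_sigma_additive.

Let tuple_measure_step_sigma_finite : sigma_finite setT tuple_measure_step.
Proof.
have /sigma_finiteP[F [FT ndF Foo]] := sigma_finiteT mu.
have /sigma_finiteP[G [GT ndG Goo]] := sigma_finiteT nu.
pose split_tuple (t : n.+1.-tuple T) : T * n.-tuple T :=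
  (tnth t ord0, [tuple of behead t]).
have msplit : measurable_fun setT split_tuple.
  apply/measurable_fun_pairP; split; first exact: measurable_tnth.
  exact: measurable_behead.
have splitK p : split_tuple (cons_pair p) = p.
  by case: p => x t; congr pair; apply/val_inj.
exists (fun k => split_tuple @^-1` (F k `*` G k)).
  apply/esym/seteqP; split => // t _.
  have [i _ Fi] : (\bigcup_k F k) (split_tuple t).1 by rewrite -FT.
  have [j _ Gj] : (\bigcup_k G k) (split_tuple t).2 by rewrite -GT.
  exists (maxn i j) => //; split => /=.
    by move: Fi; exact/subsetPset/ndF/leq_maxl.
  by move: Gj; exact/subsetPset/ndG/leq_maxr.
move=> k; have [mF Fk] := Foo k; have [mG Gk] := Goo k.
have mFG : measurable (F k `*` G k) by exact: measurableX.
split; first by rewrite -[X in measurable X]setTI; exact: msplit.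
rewrite /tuple_measure_step /pushforward -comp_preimage.
rewrite (_ : split_tuple \o cons_pair = id); last exact/funext.
by rewrite preimage_id product_measure1E// lte_mul_pinfty// ge0_fin_numE.
Qed.

HB.instance Definition _ := Measure_isSigmaFinite.Build _ _ _ tuple_measure_step
  tuple_measure_step_sigma_finite.

End tuple_measure_step.

Fixpoint tuple_measure disp (T : measurableType disp) (R : realType)
    (mu : {sigma_finite_measure set T -> \bar R}) (n : nat) :
    {sigma_finite_measure set (n.-tuple T) -> \bar R} :=
  match n with
  | 0 => \d_([tuple] : 0.-tuple T)
  | n'.+1 => tuple_measure_step mu (tuple_measure mu n')
  end.

(* R^d with its Borel sigma-algebra. *)
Notation borelRV R d := (g_sigma_algebraType (@open 'rV[R]_d)).

Section lebesgue_measureRV.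
Context (R : realType) (d : nat).

Definition row_of_tuple (t : d.-tuple (measurableTypeR R)) : borelRV R d :=
  \row_i tnth t i.

Let measurable_row_of_tuple : measurable_fun setT row_of_tuple.
Proof.
apply: (measurability (rT := borelRV R d) (@open 'rV[R]_d)) => // _ [U oU <-].
rewrite setTI.
pose D := [set p : 'rV[rat]_d * rat |
  ball (map_mx (@ratr R) p.1) (@ratr R p.2) `<=` U].
pose F p := if p \in D
  then row_of_tuple @^-1` ball (map_mx (@ratr R) p.1) (@ratr R p.2) else set0.
have -> : row_of_tuple @^-1` U = \bigcup_p F p.
  apply/seteqP; split => [t /= Ut|t [p _]]; last first.
    by rewrite /F; case: ifPn => // /set_mem Dp /=; apply: Dp.
  have /nbhs_ballP[e/= e0 eU] : nbhs (row_of_tuple t : 'rV[R]_d) U.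
    by apply: open_nbhs_nbhs.
  have [r /andP[r1 r2]] : exists r : rat, 0 < (ratr r : R) < e / 2.
    have /rat_in_itvoo[r] : 0 < e / 2 by rewrite divr_gt0.
    by rewrite in_itv/=; exists r.
  have /choice[c tc] : forall i : 'I_d, exists c : rat,
      ball (ratr c : R) (ratr r) (tnth t i).
    move=> i.
    have /rat_in_itvoo[c] : tnth t i - ratr r < tnth t i + ratr r :> R.
      by rewrite ltrBlDr -addrA ltrDl addr_gt0.
    rewrite in_itv/= => cP; exists c.
    by apply: ball_sym; rewrite ball_itv/= in_itv.
  have tb : ball (map_mx (@ratr R) (\row_i c i)) (ratr r) (\row_i tnth t i).
    by split => // i j; rewrite !mxE.
  exists (\row_i c i, r) => //; rewrite /F ifT//; apply/mem_set => /= y cy.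
  apply: eU; apply: (@le_ball _ _ _ (ratr r + ratr r)).
    by rewrite (splitr e) lerD// ltW.
  by apply: ball_triangle cy; exact: ball_sym.
apply: countable_bigcupT_measurable => // p; rewrite /F; case: ifPn => // _.
have [r0|r0] := ltP 0 (ratr p.2 : R); last first.
  rewrite (_ : _ @^-1` _ = set0)//; apply/seteqP; split => // t /= [].
  by rewrite ltNge r0.
rewrite (_ : _ @^-1` _ = \bigcap_(i in [set: 'I_d])
    (@tnth _ _ ^~ i @^-1` ball (ratr (p.1 ord0 i) : R) (ratr p.2))).
  apply: fin_bigcap_measurable => // i _.
  rewrite -[X in measurable X]setTI; apply: measurable_tnth => //.
  by rewrite ball_itv; exact: measurable_itv.
apply/seteqP; split => [t /= [_ tp] i _ /=|t /= tp].
  by have := tp ord0 i; rewrite !mxE.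
split => // i j; rewrite !mxE (ord1 i); exact: tp.
Qed.

HB.instance Definition _ := isMeasurableFun.Build _ _ _ _ row_of_tuple
  measurable_row_of_tuple.

(* The d-fold product of the one-dimensional Lebesgue measure. *)
Definition lebesgue_measureRV : set (borelRV R d) -> \bar R :=
  pushforward (tuple_measure (@lebesgue_measure R) d) row_of_tuple.

Let lebesgue_measureRV0 : lebesgue_measureRV set0 = 0%E.
Proof. exact: measure0. Qed.

Let lebesgue_measureRV_ge0 A : (0 <= lebesgue_measureRV A)%E.
Proof. exact: measure_ge0. Qed.

Let lebesgue_measureRV_sigma_additive : semi_sigma_additive lebesgue_measureRV.
Proof. exact: measure_semi_sigma_additive. Qed.

HB.instance Definition _ := isMeasure.Build _ _ _ lebesgue_measureRV
  lebesgue_measureRV0 lebesgue_measureRV_ge0 lebesgue_measureRV_sigma_additive.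

End lebesgue_measureRV.

Section euclidean.
Context {R : realType} {d : nat}.
Implicit Types (x : 'rV[R]_d) (A : set 'rV[R]_d).

(* The library's norm on 'rV[R]_d is the sup norm; this one is Euclidean. *)
Definition enorm x : R := Num.sqrt (\sum_i x ord0 i ^+ 2).

(* [inf] of the empty set is 0, so this is meaningful only for nonempty A. *)
Definition edist_set x A : R := inf [set enorm (x - y) | y in A].

Definition convex_hull A : set 'rV[R]_d :=
  smallest (@convex_set R 'rV[R]_d) A.

Definition grad (f : 'rV[R]_d -> R) x : 'rV[R]_d :=
  \row_i 'D_(delta_mx ord0 i) f x.

Definition heat_kernel (t : R) x : R :=
  (4 * pi * t) `^ (- (d%:R / 2)) * expR (- (enorm x ^+ 2 / (4 * t))).

End euclidean.

Section heat_flow.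
Context {R : realType} {d : nat}.
Variable u0 : probability (borelRV R d) R.

Definition supp : set 'rV[R]_d :=
  [set x | forall U : set 'rV[R]_d, open U -> U x -> (0 < u0 U)%E].

Definition heat_flow (x : 'rV[R]_d) (t : R) : R :=
  Rintegral u0 setT (fun y => heat_kernel t (x - y)).

Definition score (x : 'rV[R]_d) (t : R) : 'rV[R]_d :=
  grad (fun z => ln (heat_flow z t)) x.

(* Only the values of X on ]0, T] matter. Continuity on ]0, T] makes the
   terminal condition at T, where no derivative is required, effective. *)
Definition backward_solution (T : R) (xT : 'rV[R]_d) (X : R -> 'rV[R]_d) :=
  [/\ {within `]0, T]%classic, continuous X},
      (forall t, 0 < t < T -> is_derive t 1 X (- score (X t) t)) &
      X T = xT].

End heat_flow.

(* Main.v *)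
Require Import Defs.
From HB Require Import structures.
From mathcomp Require Import all_boot all_order all_algebra.
From mathcomp Require Import all_classical all_reals all_analysis.
From mathcomp Require Import measurable_realfun ring lra.

Set Implicit Arguments.
Unset Strict Implicit.
Unset Printing Implicit Defensive.

Import Order.TTheory GRing.Theory Num.Theory.
Import numFieldNormedType.Exports.

Local Open Scope classical_set_scope.
Local Open Scope ring_scope.

(** The heat flow at time [t] is the law of [Y + sqrt (2 t) G], with [Y] of law
    [u0] and [G] a standard Gaussian, and its score at [x] is [(m - x) / (2 t)],
    where [m] is the posterior mean of [Y] given the observation [x]
    ([scoreE]).  With [s = sqrt (T / t)] and [Z s = s X t] the backward equation
    therefore becomes [Z' = M (Z, s)] for [s >= 1] ([rescaled_solutionP]), where
    [M (z, s)] is the posterior mean of [Y] given [s Y + N = z] and [N] is a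
    Gaussian whose law does not depend on [s].  This equation is regular, and
    [t -> 0] is [s -> oo].

    (ii) [M] takes its values in the hull of the support.  So for a half-space
    [dot p y <= h] containing the support, [dot p (Z s) - h s] is nonincreasing.
    Applied to a half-space separating [X t] from the hull, this is the claim
    ([rescaled_hull_dist]).

    (i) The solutions transport the law of [Y + N] at [s = 1] to the law of
    [s Y + N], which has only a Gaussian tail away from [s] times the support;
    hence the terminal points whose solution stays away from the support are
    negligible.  The transport inequality is obtained neither from a flow nor
    from a change of variables, but from the Euler maps [F z = z + h M (z, s)].
    Given [s Y + N = z], the variable [(s + h) Y + N = z + h Y] has mean [F z]
    and variance of order [h ^ 2].  Thus Jensen's inequality, for a semiconvex
    [g], bounds the expectation of [g (F (s Y + N))] by that of
    [g ((s + h) Y + N)] up to [O (h ^ 2)] ([euler_step_integral]).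
    Semiconvexity survives composition with Euler maps ([euler_semiconvex]), so
    that iterating and letting [h -> 0] compares the law at a large scale with
    the law at scale 1 ([limit_mass_integral]).  The test functions are the
    semiconvex bumps supported away from the support ([far_bump_mass]), and the
    Euler scheme converges to any solution ([euler_cvg]), which also yields the
    uniqueness of solutions.

    (iii) By (i) almost every solution comes close to an atom [y] at a large
    scale.  There the posterior mean differs from [y] by a quantity that is
    exponentially small in [s ^ 2] ([pmean_near_atom]); so the solution cannot
    leave, and [Z s - s y], which is [s (X t - y)], remains bounded
    ([trapped]). *)

(** * The Euclidean structure *)

Section euclid.
Context {R : realType} {d : nat}.
Implicit Types (a b x y z : 'rV[R]_d) (A : set 'rV[R]_d).

Definition dot a b : R := \sum_i a ord0 i * b ord0 i.

Lemma dotC a b : dot a b = dot b a.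
Proof. by apply: eq_bigr => i _; rewrite mulrC. Qed.

Lemma dotDl a b x : dot (a + b) x = dot a x + dot b x.
Proof. by rewrite -big_split; apply: eq_bigr => i _; rewrite /= mxE mulrDl. Qed.

Lemma dotDr a b x : dot x (a + b) = dot x a + dot x b.
Proof. by rewrite dotC dotDl !(dotC x). Qed.

Lemma dotZl k a x : dot (k *: a) x = k * dot a x.
Proof. by rewrite mulr_sumr; apply: eq_bigr => i _; rewrite mxE mulrA. Qed.

Lemma dotZr k a x : dot x (k *: a) = k * dot x a.
Proof. by rewrite dotC dotZl (dotC x). Qed.

Lemma dotNl a x : dot (- a) x = - dot a x.
Proof. by rewrite -scaleN1r dotZl mulN1r. Qed.

Lemma dotNr a x : dot x (- a) = - dot x a.
Proof. by rewrite dotC dotNl (dotC x). Qed.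

Lemma dot0l x : dot 0 x = 0.
Proof. by rewrite -(scale0r 0) dotZl mul0r. Qed.

Definition dotE := (dotDl, dotDr, dotZl, dotZr, dotNl, dotNr).

Lemma dot_deltal i x : dot (delta_mx ord0 i) x = x ord0 i.
Proof.
rewrite /dot (bigD1 i)//= big1 ?addr0 => [|j ji]; rewrite mxE eqxx/=.
  by rewrite eqxx mul1r.
by rewrite (negbTE ji) mul0r.
Qed.

Lemma dot_ge0 x : 0 <= dot x x.
Proof. by apply: sumr_ge0 => i _; rewrite -expr2 sqr_ge0. Qed.

Lemma enorm_ge0 x : 0 <= enorm x.
Proof. exact: sqrtr_ge0. Qed.

Lemma enorm_sqr x : enorm x ^+ 2 = dot x x.
Proof.
rewrite sqr_sqrtr; last by apply: sumr_ge0 => i _; rewrite sqr_ge0.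
by apply: eq_bigr => i _; rewrite expr2.
Qed.

Lemma enorm0 : enorm (0 : 'rV[R]_d) = 0.
Proof. by apply/eqP; rewrite -sqrf_eq0 enorm_sqr dot0l. Qed.

Lemma cauchy_schwarz a b : `|dot a b| <= enorm a * enorm b.
Proof.
rewrite -(@ler_pXn2r _ 2)// ?nnegrE ?mulr_ge0 ?enorm_ge0// real_normK
  ?num_real//.
rewrite exprMn !enorm_sqr.
have [b0|b0] := eqVneq (dot b b) 0.
  suff -> : dot a b = 0 by rewrite b0 mulr0 expr0n.
  apply: big1 => i _; suff -> : b ord0 i = 0 by rewrite mulr0.
  have /eqP : b ord0 i * b ord0 i = 0.
    apply: (psumr_eq0P _ b0) => // j _.
    by rewrite -expr2 sqr_ge0.
  by rewrite mulf_eq0 orbb => /eqP.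
have bp : 0 < dot b b by rewrite lt_def b0 dot_ge0.
have := dot_ge0 (dot b b *: a - dot a b *: b).
rewrite !dotE (dotC b a) => h.
have {}h : 0 <= dot b b * (dot a a * dot b b - dot a b ^+ 2).
  by apply: le_trans h _; rewrite le_eqVlt; apply/orP; left; apply/eqP; ring.
by rewrite -subr_ge0 -(pmulr_rge0 _ bp).
Qed.

Lemma dot_le a b : dot a b <= enorm a * enorm b.
Proof. exact: le_trans (ler_norm _) (cauchy_schwarz _ _). Qed.

Lemma enormZ k x : enorm (k *: x) = `|k| * enorm x.
Proof.
apply/eqP; rewrite -(@eqrXn2 _ 2)// ?mulr_ge0 ?enorm_ge0//.
by rewrite exprMn !enorm_sqr !dotE real_normK ?num_real// expr2 mulrA.
Qed.

Lemma enormN x : enorm (- x) = enorm x.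
Proof. by rewrite -scaleN1r enormZ normrN1 mul1r. Qed.

Lemma enormB x y : enorm (x - y) = enorm (y - x).
Proof. by rewrite -enormN opprB. Qed.

Lemma enormD x y : enorm (x + y) <= enorm x + enorm y.
Proof.
rewrite -(@ler_pXn2r _ 2)// ?nnegrE ?addr_ge0 ?enorm_ge0//.
rewrite sqrrD !enorm_sqr !dotE (dotC y x).
have := dot_le x y; lra.
Qed.

Lemma enorm_triangle y x z : enorm (x - z) <= enorm (x - y) + enorm (y - z).
Proof. by rewrite -[x - z](subrKA y); exact: enormD. Qed.

Lemma enorm_eq0 x : enorm x = 0 -> x = 0.
Proof.
move=> x0; apply/rowP => i; rewrite mxE -dot_deltal.
apply/eqP; rewrite -normr_le0.
by rewrite (le_trans (cauchy_schwarz _ _))// x0 mulr0.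
Qed.

Lemma coord_le_enorm x i : `|x ord0 i| <= enorm x.
Proof.
have d1 : enorm (delta_mx ord0 i : 'rV[R]_d) = 1.
  apply/eqP; rewrite -(@eqrXn2 _ 2) ?enorm_ge0// enorm_sqr dot_deltal mxE !eqxx.
  by rewrite expr1n.
rewrite -dot_deltal; apply: le_trans (cauchy_schwarz _ _) _.
by rewrite d1 mul1r.
Qed.

(** Test the linear form on its own representative. *)
Lemma enorm_le_dual p C : 0 <= C -> (forall a, dot p a <= C * enorm a) ->
  enorm p <= C.
Proof.
move=> C0 pC; have := pC p; rewrite -enorm_sqr expr2.
have := enorm_ge0 p; rewrite le_eqVlt => /predU1P[<-//|p0].
by rewrite ler_pM2r.
Qed.

Lemma norm_le_enorm x : `|x| <= enorm x.
Proof.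
rewrite [X in X <= _]/Num.Def.normr/= mx_normrE.
apply: bigmax_le => [|[i j] _]; first exact: enorm_ge0.
by rewrite (ord1 i); exact: coord_le_enorm.
Qed.

Lemma enorm_le_norm x : enorm x <= d%:R * `|x|.
Proof.
apply: (@le_trans _ _ (\sum_i `|x ord0 i|)); last first.
  apply: (@le_trans _ _ (\sum_(i < d) `|x|)).
    apply: ler_sum => i _; rewrite [X in _ <= X]/Num.Def.normr/= mx_normrE.
    exact: (le_bigmax _ (fun ij => `|x ij.1 ij.2|) (ord0, i)).
  by rewrite sumr_const card_ord mulr_natl.
rewrite -(@ler_pXn2r _ 2)// ?nnegrE ?enorm_ge0 ?sumr_ge0//.
rewrite enorm_sqr expr2 mulr_suml; apply: ler_sum => i _.
rewrite (le_trans (ler_norm _))// normrM ler_wpM2l// (bigD1 i)//= lerDl.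
exact: sumr_ge0.
Qed.

(** Continuity on row vectors refers to the sup norm, whereas all estimates
    below are Euclidean. *)
Lemma continuous_of_modulus (f : 'rV[R]_d -> R) :
  (forall x, exists C, forall a, enorm a <= 1 ->
     `|f (x + a) - f x| <= C * enorm a) -> continuous f.
Proof.
move=> H x; have [C fC] := H x; move=> U /= /(@nbhs_ballP _ R^o)[e e0 eU].
pose k := e / (`|C| + 1).
have k0 : 0 < k by rewrite divr_gt0// ltr_wpDl.
pose r := Num.min 1 k / (d%:R + 1).
have d0 : 0 < d%:R + 1 :> R by rewrite ltr_wpDl.
have r0 : 0 < r by rewrite divr_gt0// lt_min ltr01.
apply/nbhs_ballP; exists r => // y; rewrite -ball_normE /= => yr.
apply: eU; rewrite -ball_normE /= distrC; change (`|f y - f x| < e).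
have xy : enorm (y - x) < Num.min 1 k.
  apply: le_lt_trans (enorm_le_norm _) _; rewrite distrC in yr.
  rewrite -(@ltr_pM2l _ (d%:R + 1)) // in yr.
  rewrite /r mulrCA divff ?gt_eqF// mulr1 in yr; apply: le_lt_trans yr.
  by rewrite ler_wpM2r// lerDl.
have := fC (y - x); rewrite subrKC => h.
move: xy; rewrite lt_min => /andP[x1 xk].
apply: le_lt_trans (h (ltW x1)) _.
apply: (@le_lt_trans _ _ ((`|C| + 1) * enorm (y - x))).
  by rewrite ler_wpM2r ?enorm_ge0// (le_trans (ler_norm _))// lerDl.
by rewrite -ltr_pdivlMl ?ltr_wpDl// mulrC.
Qed.

Lemma continuous_dotr a : continuous (dot a).
Proof.
apply: continuous_of_modulus => x; exists (enorm a) => y _.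
by rewrite dotDr addrAC subrr add0r cauchy_schwarz.
Qed.

Lemma enorm_dist x y : `|enorm x - enorm y| <= enorm (x - y).
Proof.
rewrite ler_norml; apply/andP; split.
  by have := enormD x (y - x); rewrite subrKC enormB; lra.
by have := enormD y (x - y); rewrite subrKC; lra.
Qed.

Lemma continuous_enorm : continuous (@enorm R d).
Proof.
apply: continuous_of_modulus => x; exists 1 => y _.
by rewrite mul1r (le_trans (enorm_dist _ _))// addrAC subrr add0r.
Qed.

Lemma edist_set_ge0 x A : 0 <= edist_set x A.
Proof.
have [->|/set0P A0] := eqVneq A set0;
  first by rewrite /edist_set image_set0 inf0.
apply: lb_le_inf => [|_ [y _ <-]]; last exact: enorm_ge0.
by have [y Ay] := A0; exists (enorm (x - y)), y.
Qed.

Lemma has_lbound_edist x A : has_lbound [set enorm (x - y) | y in A].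
Proof. by exists 0 => _ [y _ <-]; exact: enorm_ge0. Qed.

Lemma edist_set_le x A y : A y -> edist_set x A <= enorm (x - y).
Proof. by move=> Ay; apply: ge_inf; [exact: has_lbound_edist|exists y]. Qed.

Lemma edist_set_adherent x A e : A !=set0 -> 0 < e ->
  exists2 y, A y & enorm (x - y) < edist_set x A + e.
Proof.
move=> [z Az] e0.
have hi : has_inf [set enorm (x - y) | y in A].
  by split; [exists (enorm (x - z)), z|exact: has_lbound_edist].
by have [_ [y Ay <-] ?] := inf_adherent e0 hi; exists y.
Qed.

Lemma le_edist_set x A e : A !=set0 -> (forall y, A y -> e <= enorm (x - y)) ->
  e <= edist_set x A.
Proof.
by move=> [z Az] H; apply: lb_le_inf => [|_ [y Ay <-]];
  [exists (enorm (x - z)), z|exact: H].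
Qed.

End euclid.

(** * Supports of measures *)

Section rational_balls.
Context {R : realType} {d : nat}.

Definition rat_ball (p : 'rV[rat]_d * rat) : set 'rV[R]_d :=
  ball (map_mx (@ratr R) p.1) (ratr p.2).

Lemma rat_ball_basis (U : set 'rV[R]_d) (x : 'rV[R]_d) : nbhs x U ->
  exists2 p, rat_ball p x & rat_ball p `<=` U.
Proof.
move=> /nbhs_ballP[e/= e0 eU].
have [r /andP[r1 r2]] : exists r : rat, 0 < (ratr r : R) < e / 2.
  have /rat_in_itvoo[r] : 0 < e / 2 by rewrite divr_gt0.
  by rewrite in_itv/=; exists r.
have /choice[c xc] : forall i : 'I_d, exists c : rat,
    ball (ratr c : R) (ratr r) (x ord0 i).
  move=> i; have /rat_in_itvoo[c] : x ord0 i - ratr r < x ord0 i + ratr r :> R.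
    by rewrite ltrBlDr -addrA ltrDl addr_gt0.
  rewrite in_itv/= => cP; exists c.
  by apply: ball_sym; rewrite ball_itv/= in_itv.
have xb : rat_ball (\row_i c i, r) x.
  by split => // i j; rewrite !mxE (ord1 i).
exists (\row_i c i, r) => // y cy.
apply: eU; apply: (@le_ball _ _ _ (ratr r + ratr r)).
  by rewrite (splitr e) lerD// ltW.
by apply: ball_triangle cy; exact: ball_sym.
Qed.

Lemma open_measurableRV (U : set 'rV[R]_d) :
  open U -> measurable (U : set (borelRV R d)).
Proof. exact: sub_sigma_algebra. Qed.

Lemma closed_measurableRV (F : set 'rV[R]_d) :
  closed F -> measurable (F : set (borelRV R d)).
Proof.
move=> cF; rewrite -[F]setCK; apply: measurableC.
by apply: open_measurableRV; rewrite openC.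
Qed.

Lemma continuous_measurableRV (f : 'rV[R]_d -> R) :
  continuous f -> measurable_fun setT (f : borelRV R d -> R).
Proof.
move=> /continuousP cf.
apply: (measurability _ (measurable_realfun.RGenOpens.measurableE R)).
move=> _ [_ [a [b ->] <-]]; rewrite setTI; apply: open_measurableRV.
exact/cf/interval_open.
Qed.

End rational_balls.

Section support.
Context {R : realType} {d : nat} (u0 : probability (borelRV R d) R).

Lemma supp_closed : closed (supp u0).
Proof.
move=> x clx U oU Ux.
have [y [Sy Uy]] := clx U (open_nbhs_nbhs (conj oU Ux)).
exact: Sy.
Qed.

(** A point outside the support has a null rational ball around it, and there
    are countably many of these. *)
Lemma suppC_null : u0 (~` supp u0) = 0%E.
Proof.
pose F (n : nat) : set 'rV[R]_d := if unpickle n is Some p then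
  if u0 (rat_ball p : set 'rV[R]_d) == 0%E then rat_ball p else set0 else set0.
have F0 n : measurable (F n : set (borelRV R d)) /\ u0 (F n) = 0%E.
  rewrite /F; case: unpickle => [p|]; last by rewrite measure0.
  case: eqP => [->|_]; last by rewrite measure0.
  by split=> //; apply: open_measurableRV; exact: ball_open.
have : u0.-negligible (\bigcup_n F n).
  by apply: negligible_bigcup => n; have [mF /negligibleP] := F0 n; exact.
have mS : measurable (~` supp u0 : set (borelRV R d)).
  by apply: open_measurableRV; rewrite openC; exact: supp_closed.
move=> /(negligibleS _) h; apply/(negligibleP _ mS)/h => x /= Sx.
have [U [oU Ux u0U]] : exists U : set 'rV[R]_d, [/\ open U, U x & u0 U = 0%E].
  apply: contrapT => /forallNP H; apply: Sx => U oU Ux.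
  rewrite lt0e measure_ge0 andbT; apply/eqP => U0; exact: (H U).
have [p px pU] := rat_ball_basis (open_nbhs_nbhs (conj oU Ux)).
exists (pickle p) => //; rewrite /F pickleK ifT//.
rewrite -measure_le0 -u0U le_measure// inE; apply: open_measurableRV => //.
exact: ball_open.
Qed.

Lemma supp_measurable : measurable (supp u0 : set (borelRV R d)).
Proof. by apply: closed_measurableRV; exact: supp_closed. Qed.

Lemma supp_full : u0 (supp u0) = 1%E.
Proof.
have := probability_setC u0 (measurableC supp_measurable).
by rewrite setCK suppC_null sube0.
Qed.

Lemma supp_nonempty : supp u0 !=set0.
Proof.
apply/set0P/eqP => S0; have := supp_full.
by rewrite S0 measure0 => /eqP; rewrite eqe eq_sym oner_eq0.
Qed.

End support.

(** * Averages with exponential weights *)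

Section continuity.
Context {R : realType} {d : nat}.
Implicit Types f g : 'rV[R]_d -> R.

Lemma contD f g : continuous f -> continuous g ->
  continuous (fun y => f y + g y).
Proof. by move=> cf cg x; apply: (@continuousD _ R^o);
  [exact: cf|exact: cg]. Qed.

Lemma contM f g : continuous f -> continuous g ->
  continuous (fun y => f y * g y).
Proof. by move=> cf cg x; apply: continuousM; [exact: cf|exact: cg]. Qed.

Lemma contC (c : R) : continuous (fun _ : 'rV[R]_d => c).
Proof. by move=> x; exact: cst_continuous. Qed.

Lemma contN f : continuous f -> continuous (fun y => - f y).
Proof. by move=> cf x; apply: (@continuousN _ R^o); exact: cf. Qed.

Lemma contB f g : continuous f -> continuous g ->
  continuous (fun y => f y - g y).
Proof. by move=> cf cg; apply: contD cf _; exact: contN. Qed.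

Lemma cont_expR f : continuous f -> continuous (fun y => expR (f y)).
Proof.
move=> cf x; apply: (@continuous_comp _ _ _ f expR); first exact: cf.
exact: continuous_expR.
Qed.

Lemma cont_norm f : continuous f -> continuous (fun y => `|f y|).
Proof.
move=> cf x; apply: (@continuous_comp _ _ _ f Num.norm); first exact: cf.
exact: (@norm_continuous _ R^o).
Qed.

Lemma cont_dotl (a : 'rV[R]_d) : continuous (fun y => dot y a).
Proof. by under eq_fun do rewrite dotC; exact: continuous_dotr. Qed.

Lemma cont_enorm2 (a : 'rV[R]_d) k : 
  continuous (fun y : 'rV[R]_d => enorm (a - k *: y) ^+ 2).
Proof.
rewrite (_ : (fun _ => _) = fun y : 'rV[R]_d =>
    (dot a a - k * dot a y - k * dot y a) + k * (k * dot y y)); last first.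
  by apply/funext => y; rewrite enorm_sqr !dotE; ring.
have cd : continuous (fun y : 'rV[R]_d => k * dot y a).
  by apply: contM; [exact: contC|exact: cont_dotl].
have cd' : continuous (fun y : 'rV[R]_d => k * dot a y).
  by apply: contM; [exact: contC|exact: continuous_dotr].
have cs : continuous (fun y : 'rV[R]_d => k * (k * dot y y)).
  apply: contM; first exact: contC.
  apply: contM; first exact: contC.
  under eq_fun do rewrite -enorm_sqr expr2.
  by apply: contM; exact: continuous_enorm.
by apply: contD cs; apply: contB cd; apply: contB cd'; exact: contC.
Qed.

End continuity.

Section averages.
Context {R : realType} {d : nat} (u0 : probability (borelRV R d) R).
Hypothesis cS : compact (supp u0).
Implicit Types (f g psi phi : 'rV[R]_d -> R).
Let S := supp u0.

Definition sint f : R := \int[u0]_(y in supp u0) f y.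

Lemma cont_max f : continuous f ->
  exists2 c, S c & forall y, S y -> f y <= f c.
Proof.
move=> cf; have [c /set_mem Sc fc] := compact_EVT_max (supp_nonempty u0) cS
  (continuous_subspaceT cf).
by exists c => // y Sy; apply: fc; exact/mem_set.
Qed.

Lemma cont_min f : continuous f ->
  exists2 c, S c & forall y, S y -> f c <= f y.
Proof.
move=> cf; have [c /set_mem Sc fc] := compact_EVT_min (supp_nonempty u0) cS
  (continuous_subspaceT cf).
by exists c => // y Sy; apply: fc; exact/mem_set.
Qed.

Lemma supp_bounded : exists2 B, 1 <= B & forall y, S y -> enorm y <= B.
Proof.
have [c Sc cP] := cont_max (@continuous_enorm R d).
exists (1 + enorm c) => [|y Sy]; first by rewrite lerDl enorm_ge0.
by rewrite (le_trans (cP _ Sy))// lerDr.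
Qed.

Lemma cont_integrable f : continuous f -> u0.-integrable S (EFin \o f).
Proof.
move=> cf; have [c Sc cP] := cont_max (cont_norm cf).
apply: measurable_bounded_integrable.
- exact: supp_measurable.
- by apply: (@le_lt_trans _ _ 1%E);
  [exact: probability_le1 (supp_measurable u0)|exact: ltry].
- by apply: measurable_funTS; exact: continuous_measurableRV.
exists `|f c|; split; first exact: num_real.
by move=> x xc y Sy; exact: le_trans (cP _ Sy) (ltW xc).
Qed.

Lemma sintD f g : continuous f -> continuous g ->
  sint (fun y => f y + g y) = sint f + sint g.
Proof.
by move=> cf cg; apply: RintegralD;
  [exact: supp_measurable|exact: cont_integrable|exact: cont_integrable].
Qed.

Lemma sintZ k f : continuous f -> sint (fun y => k * f y) = k * sint f.
Proof.
by move=> cf; apply: RintegralZl;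
  [exact: supp_measurable|exact: cont_integrable].
Qed.

Lemma sint_le f g : continuous f -> continuous g ->
  (forall y, S y -> f y <= g y) -> sint f <= sint g.
Proof.
by move=> cf cg fg; apply: le_Rintegral => //;
  [exact: supp_measurable|exact: cont_integrable|exact: cont_integrable].
Qed.

Lemma eq_sint f g : (forall y, S y -> f y = g y) -> sint f = sint g.
Proof. by move=> fg; apply: eq_Rintegral => y /set_mem; exact: fg. Qed.

Lemma sint_cst k : sint (fun=> k) = k.
Proof.
transitivity (k * fine (u0 (supp u0))).
  by apply: Rintegral_cst; exact: supp_measurable.
by rewrite supp_full mulr1.
Qed.

Lemma sint_gt0 f : continuous f -> (forall y, S y -> 0 < f y) -> 0 < sint f.
Proof.
move=> cf f0; have [c Sc fc] := cont_min cf.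
by rewrite (lt_le_trans (f0 _ Sc))// -[leLHS]sint_cst sint_le//; exact: contC.
Qed.

(** The expectation under the probability measure with density proportional
    to [exp psi] with respect to the base measure. *)
Definition avg psi f : R :=
  sint (fun y => f y * expR (psi y)) / sint (fun y => expR (psi y)).

Lemma sint_exp_gt0 psi : continuous psi -> 0 < sint (fun y => expR (psi y)).
Proof.
by move=> cp; apply: sint_gt0 => [|y _]; [exact: cont_expR|exact: expR_gt0].
Qed.

Lemma eq_avg psi f g : (forall y, S y -> f y = g y) -> avg psi f = avg psi g.
Proof.
by move=> fg; rewrite /avg; congr (_ / _); apply: eq_sint => y Sy; rewrite fg.
Qed.

Lemma avgD psi f g : continuous psi -> continuous f -> continuous g ->
  avg psi (fun y => f y + g y) = avg psi f + avg psi g.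
Proof.
move=> cp cf cg; rewrite /avg -mulrDl -sintD; [|exact/contM/cont_expR..].
by congr (_ / _); apply: eq_sint => y _; rewrite mulrDl.
Qed.

Lemma avgZ psi k f : continuous psi -> continuous f ->
  avg psi (fun y => k * f y) = k * avg psi f.
Proof.
move=> cp cf; rewrite /avg mulrA -sintZ; last exact/contM/cont_expR.
by congr (_ / _); apply: eq_sint => y _; rewrite mulrA.
Qed.

Lemma avg_cst psi k : continuous psi -> avg psi (fun=> k) = k.
Proof.
move=> cp; rewrite /avg sintZ; last exact: cont_expR.
by rewrite mulfK// gt_eqF// sint_exp_gt0.
Qed.

Lemma avgB psi f g : continuous psi -> continuous f -> continuous g ->
  avg psi (fun y => f y - g y) = avg psi f - avg psi g.
Proof.
move=> cp cf cg; rewrite -[- avg psi g]mulN1r -avgZ// -avgD//.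
- by apply: eq_avg => y _; rewrite mulN1r.
- by apply: contM cg; exact: contC.
Qed.

Lemma avg_le psi f g : continuous psi -> continuous f -> continuous g ->
  (forall y, S y -> f y <= g y) -> avg psi f <= avg psi g.
Proof.
move=> cp cf cg fg; rewrite /avg ler_pM2r ?invr_gt0 ?sint_exp_gt0//.
apply: sint_le; [exact/contM/cont_expR..|].
by move=> y Sy; rewrite ler_pM2r ?expR_gt0// fg.
Qed.

Lemma avg_le_cst psi f k : continuous psi -> continuous f ->
  (forall y, S y -> f y <= k) -> avg psi f <= k.
Proof.
move=> cp cf fk; rewrite -[leRHS](avg_cst k cp).
by apply: avg_le => //; exact: contC.
Qed.

Lemma avg_norm_le psi f k : continuous psi -> continuous f ->
  (forall y, S y -> `|f y| <= k) -> `|avg psi f| <= k.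
Proof.
move=> cp cf fk; rewrite ler_norml -[- k]mulN1r -lerN2 mulN1r opprK.
rewrite -[- avg psi f]mulN1r -avgZ//; apply/andP; split;
  apply: avg_le_cst => //.
- by apply: contM cf; exact: contC.
- by move=> y /fk; rewrite mulN1r ler_norml lerNl => /andP[].
- by move=> y /fk; rewrite ler_norml => /andP[].
Qed.

Lemma avg_tilt psi phi f : continuous psi -> continuous phi -> continuous f ->
  avg (fun y => psi y + phi y) f =
  avg psi (fun y => f y * expR (phi y)) / avg psi (fun y => expR (phi y)).
Proof.
move=> cp cph cf; rewrite /avg.
have p0 := sint_exp_gt0 cp.
have q0 : 0 < sint (fun y => expR (phi y) * expR (psi y)).
  apply: sint_gt0 => [|y _]; first by apply: contM; exact: cont_expR.
  by rewrite mulr_gt0 ?expR_gt0.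
rewrite invf_div mulrA divfK ?gt_eqF//; congr (_ / _); apply: eq_sint => y _.
  by rewrite expRD; ring.
by rewrite expRD mulrC.
Qed.

Lemma avg_shift psi k f : continuous psi -> continuous f ->
  avg (fun y => psi y + k) f = avg psi f.
Proof.
move=> cp cf; have ck : continuous (fun _ : 'rV[R]_d => k) by exact: contC.
rewrite avg_tilt// avg_cst// (_ : avg psi _ = expR k * avg psi f).
  by rewrite mulrC mulKf// gt_eqF ?expR_gt0.
by rewrite -avgZ//; apply: eq_avg => y _; rewrite mulrC.
Qed.

End averages.

(** * Tilted averages *)

Section exp_taylor.
Context {R : realType}.

Lemma expR_taylor1 (x : R) : x <= 1 / 2 -> 0 <= expR x - 1 - x <= 2 * x ^+ 2.
Proof.
move=> x2; apply/andP; split; first by have := expR_ge1Dx x; lra.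
have h1 : 0 < 1 - x by lra.
have h2 := expR_ge1Dx (- x).
have : expR x * (1 - x) <= 1.
  rewrite -[leRHS](expRxMexpNx_1 x) ler_pM2l ?expR_gt0//.
rewrite -ler_pdivlMr// => /le_trans h; rewrite -subr_ge0.
suff : 1 / (1 - x) <= 1 + x + 2 * x ^+ 2 by move=> /h; lra.
rewrite ler_pdivrMr//.
have : 0 <= x ^+ 2 * (1 - 2 * x) by rewrite mulr_ge0 ?sqr_ge0//; lra.
nra.
Qed.

End exp_taylor.

Section tilt.
Context {R : realType} {d : nat} (u0 : probability (borelRV R d) R).
Hypothesis cS : compact (supp u0).
Implicit Types (f g psi phi : 'rV[R]_d -> R).
Let S := supp u0.

(** First-order expansion of an exponentially tilted average.  For [D <= 1/2]
    expand the exponential in numerator and denominator; for larger [D] the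
    trivial bounds on both averages suffice. *)
Lemma avg_tilt_taylor psi phi f (B D : R) : continuous psi -> continuous phi ->
  continuous f -> 0 <= B -> 0 <= D -> avg u0 psi f = 0 ->
  (forall y, S y -> `|f y| <= B) -> (forall y, S y -> `|phi y| <= D) ->
  `|avg u0 (fun y => psi y + phi y) f - avg u0 psi (fun y => f y * phi y)|
    <= 10 * B * D ^+ 2.
Proof.
move=> cp cph cf B0 D0 f0 fB phiD.
have cfp : continuous (fun y => f y * phi y) by exact: contM.
have ce : continuous (fun y => expR (phi y)) by exact: cont_expR.
have main1 : `|avg u0 psi (fun y => f y * phi y)| <= B * D.
  by apply: avg_norm_le => // y Sy; rewrite normrM ler_pM// ?fB ?phiD.
have [D2|D2] := lerP D (1 / 2); last first.
  have : `|avg u0 (fun y => psi y + phi y) f| <= B.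
    by apply: avg_norm_le => //; exact: contD.
  move=> main2; apply: le_trans (ler_normB _ _) _.
  apply: le_trans (lerD main2 main1) _.
  have h : 0 <= B * (D - 1 / 2) by rewrite mulr_ge0// subr_ge0 ltW.
  have h' : 0 <= B * (D - 1 / 2) * D by rewrite mulr_ge0.
  nra.
pose rho y := expR (phi y) - 1 - phi y.
have cr : continuous rho by apply: contB cph; apply: contB ce _; exact: contC.
have rhoD y : S y -> 0 <= rho y <= 2 * D ^+ 2.
  move=> Sy; have := phiD _ Sy; rewrite ler_norml => /andP[h1 h2].
  have /andP[-> h3] := expR_taylor1 (le_trans h2 D2);
    apply: le_trans h3 _ => /=.
  by nra.
have dE : avg u0 psi (fun y => expR (phi y)) =
    1 + avg u0 psi phi + avg u0 psi rho.
  rewrite -[X in X + _ + _](avg_cst cS 1 cp) -!avgD//; last 2 first.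
  - by apply: contD cph; exact: contC.
  - exact: contC.
  by apply: eq_avg => y _; rewrite /rho; ring.
have nE : avg u0 psi (fun y => f y * expR (phi y)) =
    avg u0 psi (fun y => f y * phi y) + avg u0 psi (fun y => f y * rho y).
  have cfr : continuous (fun y => f y * rho y) by exact: contM.
  rewrite -[RHS]add0r -f0 -!avgD//; last exact: contD.
  by apply: eq_avg => y _; rewrite /rho; ring.
have aphi : `|avg u0 psi phi| <= D by exact: avg_norm_le.
have arho : 0 <= avg u0 psi rho <= 2 * D ^+ 2.
  apply/andP; split; last by apply: avg_le_cst => // y /rhoD /andP[].
  rewrite -[leLHS](avg_cst cS 0 cp); apply: avg_le => //; first exact: contC.
  by move=> y /rhoD /andP[].
have afr : `|avg u0 psi (fun y => f y * rho y)| <= B * (2 * D ^+ 2).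
  apply: avg_norm_le => //; first exact: contM.
  by move=> y Sy; have /andP[r0 r1] := rhoD y Sy;
    rewrite normrM ler_pM// ?fB// ger0_norm.
rewrite avg_tilt//.
set n := avg u0 psi (fun y => _ * expR _) in nE *.
set q := avg u0 psi (fun y => expR _) in dE *.
set m := avg u0 psi (fun y => f y * phi y) in main1 nE *.
set r := avg u0 psi (fun y => f y * rho y) in nE afr.
move: aphi; rewrite (ler_norml (avg _ _ phi)) => /andP[p1 p2].
move: arho => /andP[r1 r2].
have q1 : 1 / 2 <= q by rewrite dE; lra.
have q0 : 0 < q by lra.
have qD : `|q - 1| <= 2 * D.
  by rewrite ler_norml dE; apply/andP; split; nra.
rewrite (_ : n / q - m = r - n * (q - 1) / q); last first.
  by rewrite nE; field; rewrite gt_eqF.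
apply: le_trans (ler_normB _ _) _.
have nB : `|n| <= 2 * B * D.
  rewrite nE; apply: le_trans (ler_normD _ _) _.
  have : 0 <= B * D * (1 / 2 - D) by rewrite !mulr_ge0// subr_ge0.
  nra.
have : `|n * (q - 1) / q| <= 8 * B * D ^+ 2.
  rewrite normrM [X in _ * X]ger0_norm ?invr_ge0 ?(ltW q0)//.
  rewrite ler_pdivrMr// normrM; apply: (@le_trans _ _ (2 * B * D * (2 * D)));
    first by rewrite ler_pM.
  have : 0 <= B * D ^+ 2 * (q - 1 / 2) by rewrite !mulr_ge0 ?sqr_ge0// subr_ge0.
  nra.
nra.
Qed.

Lemma avg_tilt_lip psi phi f (B D : R) : continuous psi -> continuous phi ->
  continuous f -> 0 <= B -> 0 <= D ->
  (forall y, S y -> `|f y| <= B) -> (forall y, S y -> `|phi y| <= D) ->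
  `|avg u0 (fun y => psi y + phi y) f - avg u0 psi f| <= 22 * B * D.
Proof.
move=> cp cph cf B0 D0 fB phiD.
have cpp : continuous (fun y => psi y + phi y) by exact: contD.
have mB : `|avg u0 psi f| <= B by exact: avg_norm_le.
have [D2|D2] := lerP D (1 / 2); last first.
  apply: le_trans (ler_normB _ _) _.
  have mB' : `|avg u0 (fun y => psi y + phi y) f| <= B by exact: avg_norm_le.
  have h : 0 <= B * (D - 1 / 2) by rewrite mulr_ge0// subr_ge0 ltW.
  nra.
pose m := avg u0 psi f; pose g y := f y - m.
have cg : continuous g by apply: contB => //; exact: contC.
have gB y : S y -> `|g y| <= 2 * B.
  by move=> /fB fB'; apply: le_trans (ler_normB _ _) _; move: mB; rewrite -/m;
    lra.
have g0 : avg u0 psi g = 0.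
  by rewrite avgB// ?avg_cst ?subrr//; exact: contC.
have B20 : 0 <= 2 * B by lra.
have := avg_tilt_taylor cp cph cg B20 D0 g0 gB phiD.
rewrite [X in `|X - _|]avgB//; last exact: contC.
rewrite avg_cst// -/m => h.
have : `|avg u0 psi (fun y => g y * phi y)| <= 2 * B * D.
  apply: avg_norm_le => //; first exact: contM.
  by move=> y Sy; rewrite normrM ler_pM// ?gB ?phiD.
move=> h'; set X := avg u0 _ f in h *; set Y := avg u0 psi _ in h h'.
rewrite -[X - m](subrK Y); apply: le_trans (ler_normD _ _) _.
have : 0 <= B * D * (1 / 2 - D) by rewrite !mulr_ge0// subr_ge0.
nra.
Qed.

(** The vector [E_psi (f Y)], [Y] the point of the support. *)
Definition vavg psi f : 'rV[R]_d := \row_i avg u0 psi (fun y => f y * y ord0 i).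

Lemma dot_vavg psi f a : continuous psi -> continuous f ->
  dot a (vavg psi f) = avg u0 psi (fun y => f y * dot a y).
Proof.
move=> cp cf; rewrite /dot /vavg.
transitivity (avg u0 psi (fun y => \sum_i a ord0 i * (f y * y ord0 i)));
  last first.
  by apply: eq_avg => y _; rewrite mulr_sumr; apply: eq_bigr => i _;
    rewrite mulrCA.
have cc i : continuous (fun y : 'rV[R]_d => a ord0 i * (f y * y ord0 i)).
  by apply: contM; [exact: contC|apply: contM cf _; exact: coord_continuous].
suff /(_ (index_enum 'I_d)) [] : forall r : seq 'I_d,
    \sum_(i <- r) a ord0 i * (\row_i0 avg u0 psi (fun y => f y * y ord0 i0))
      ord0 i =
    avg u0 psi (fun y => \sum_(i <- r) a ord0 i * (f y * y ord0 i)) /\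
    continuous (fun y => \sum_(i <- r) a ord0 i * (f y * y ord0 i)) by [].
elim=> [|i r [IH cIH]].
  rewrite big_nil; split.
    by under eq_fun do rewrite big_nil; rewrite avg_cst.
  by under eq_fun do rewrite big_nil; exact: contC.
split; last by under eq_fun do rewrite big_cons; exact: contD.
rewrite big_cons IH; under [in RHS]eq_fun do rewrite big_cons.
rewrite avgD// mxE avgZ//; apply: contM cf _; exact: coord_continuous.
Qed.

End tilt.

(** * The posterior mean *)

Section posterior.
Context {R : realType} {d : nat} (u0 : probability (borelRV R d) R) (T : R).
Hypotheses (T0 : 0 < T) (cS : compact (supp u0)).
Implicit Types (f g : 'rV[R]_d -> R) (p q z a y : 'rV[R]_d) (s : R).
Let S := supp u0.

Definition gexp z s y : R := - (enorm (z - s *: y) ^+ 2 / (4 * T)).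

Lemma cont_gexp z s : continuous (gexp z s).
Proof. by apply: contN; apply: contM; [exact: cont_enorm2|exact: contC]. Qed.

Fact pmean_key : unit. Proof. exact: tt. Qed.
(** The posterior mean of [Y] given [s Y + N = z], for [Y] of law [u0] and an
    independent Gaussian [N] of covariance [2 T I].  It is locked so that it
    does not unfold to the integrals defining it. *)
Definition pmean : 'rV[R]_d -> R -> 'rV[R]_d :=
  locked_with pmean_key (fun z s => vavg u0 (gexp z s) (fun=> 1)).

Lemma dot_pmean p z s : dot p (pmean z s) = avg u0 (gexp z s) (dot p).
Proof.
rewrite /pmean unlock dot_vavg//; [|exact: cont_gexp|exact: contC].
by apply: eq_avg => y _; rewrite mul1r.
Qed.

Lemma enorm_pmean B z s : 0 <= B -> (forall y, S y -> enorm y <= B) ->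
  enorm (pmean z s) <= B.
Proof.
move=> B0 SB; apply: enorm_le_dual => // a.
rewrite dotC dot_pmean; apply: avg_le_cst => //;
  [exact: cont_gexp|exact: continuous_dotr|].
by move=> y /SB yB; rewrite (le_trans (dot_le _ _))// mulrC ler_wpM2r
  ?enorm_ge0.
Qed.

Lemma pmean_dist z s z' s' phi k B D : continuous phi ->
  0 <= B -> 0 <= D -> (forall y, S y -> enorm y <= B) ->
  (forall y, S y -> `|phi y| <= D) ->
  (forall y, gexp z' s' y = gexp z s y + phi y + k) ->
  enorm (pmean z' s' - pmean z s) <= 22 * B * D.
Proof.
move=> cph B0 D0 SB phiD E.
have C0 : 0 <= 22 * B * D by rewrite !mulr_ge0.
apply: enorm_le_dual => // p.
have E' : gexp z' s' = fun y => gexp z s y + phi y + k by exact/funext.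
have cg : continuous (gexp z s) by exact: cont_gexp.
have cd : continuous (dot p) by exact: continuous_dotr.
rewrite dotC dotDr dotNr (dot_pmean p z' s') (dot_pmean p z s) E'.
rewrite avg_shift//; last exact: contD.
apply: le_trans (ler_norm _) _.
rewrite (_ : 22 * B * D * enorm p = 22 * (enorm p * B) * D); last by ring.
apply: avg_tilt_lip => //; first by rewrite mulr_ge0 ?enorm_ge0.
by move=> y /SB yB; rewrite (le_trans (cauchy_schwarz _ _))// ler_wpM2l
  ?enorm_ge0.
Qed.

Lemma gexp_shift z a s y : gexp (z + a) s y =
  gexp z s y + s / (2 * T) * dot a y + (- ((dot a a + 2 * dot z a) / (4 * T))).
Proof. by rewrite /gexp !enorm_sqr !dotE !(dotC y) !(dotC a z); field;
  rewrite gt_eqF. Qed.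

(** Both variables enter through the exponent of the weight, and on the compact
    support the increments of the exponent are controlled by theirs. *)
Lemma pmean_lip (rho Sg : R) : 0 <= rho -> 0 <= Sg -> exists2 L, 0 <= L &
  forall z s z' s', enorm z <= rho -> 0 <= s <= Sg -> 0 <= s' <= Sg ->
  enorm (pmean z' s' - pmean z s) <= L * (enorm (z' - z) + `|s' - s|).
Proof.
move=> rho0 Sg0; have [B B1 SB] := supp_bounded cS.
have B0 : 0 <= B by exact: le_trans B1.
have Ti : 0 < (4 * T)^-1 by rewrite invr_gt0 mulr_gt0.
pose K := (4 * T)^-1 * (2 * B) * (rho + Sg * (1 + B)).
have K0 : 0 <= K.
  by rewrite !mulr_ge0 ?(ltW Ti)// addr_ge0// mulr_ge0// addr_ge0.
exists (22 * B * K); first by rewrite mulr_ge0 ?K0// mulr_ge0.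
move=> z s z' s' zr /andP[s0 sS] /andP[s'0 s'S].
set e := enorm (z' - z); set h := `|s' - s|.
have e0 : 0 <= e by exact: enorm_ge0.
have h0 : 0 <= h by exact: normr_ge0.
pose phi y := (4 * T)^-1 * (2 * (s' * dot (z' - z) y + (s' - s) * dot z y)
   + (- (s' - s) * (s' + s)) * dot y y).
pose k := (dot z z - dot z' z') / (4 * T).
rewrite -mulrA; apply: (@pmean_dist _ _ _ _ phi k) => //.
- have cyy : continuous (fun y : 'rV[R]_d => dot y y).
    under eq_fun do rewrite -enorm_sqr expr2.
    by apply: contM; exact: continuous_enorm.
  apply: contM; first exact: contC.
  apply: contD; last by apply: contM cyy; exact: contC.
  apply: contM; first exact: contC.
  by apply: contD; (apply: contM; [exact: contC|exact: continuous_dotr]).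
- by rewrite mulr_ge0// addr_ge0.
- move=> y Sy; have yB := SB _ Sy.
  have d1 : `|dot (z' - z) y| <= e * B.
    by rewrite (le_trans (cauchy_schwarz _ _))// ler_wpM2l.
  have d2 : `|dot z y| <= rho * B.
    by rewrite (le_trans (cauchy_schwarz _ _))// ler_pM// enorm_ge0.
  have d3 : `|dot y y| <= B * B.
    by rewrite (le_trans (cauchy_schwarz _ _))// ler_pM// enorm_ge0.
  rewrite (_ : K * (e + h) =
    (4 * T)^-1 * (2 * B * (rho + Sg * (1 + B)) * (e + h)));
      last by rewrite /K; ring.
  rewrite /phi normrM gtr0_norm// ler_pM2l//.
  apply: le_trans (ler_normD _ _) _.
  have n1 : `|2 * (s' * dot (z' - z) y + (s' - s) * dot z y)| <=
      2 * (Sg * (e * B) + h * (rho * B)).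
    rewrite normrM ger0_norm// ler_pM2l//; apply: le_trans (ler_normD _ _) _.
    by rewrite !normrM lerD// ler_pM// ger0_norm.
  have n2 : `|- (s' - s) * (s' + s) * dot y y| <= h * (2 * Sg) * (B * B).
    rewrite !normrM normrN ler_pM ?mulr_ge0// ler_pM// ger0_norm ?addr_ge0//.
    by lra.
  apply: le_trans (lerD n1 n2) _.
  have := mulr_ge0 (mulr_ge0 B0 e0) (addr_ge0 rho0 (mulr_ge0 Sg0 B0)).
  have := mulr_ge0 (mulr_ge0 B0 h0) Sg0.
  nra.
- by move=> y; rewrite /phi /k /gexp !enorm_sqr !dotE !(dotC y); field;
  rewrite gt_eqF.
Qed.

(** Second-order control of the posterior mean.  The vector [q] is the
    posterior covariance applied to [p], up to the factor [s / (2 T)]. *)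
Lemma pmean_taylor (Sg : R) : 0 <= Sg -> exists2 L, 0 <= L &
  forall z s, 0 <= s <= Sg ->
    (forall a, enorm (pmean (z + a) s - pmean z s) <= L * enorm a) /\
    forall p, exists2 q, enorm q <= L * enorm p & forall a,
      `|dot p (pmean (z + a) s - pmean z s) - dot q a|
        <= L * enorm p * enorm a ^+ 2.
Proof.
move=> Sg0; have [B B1 SB] := supp_bounded cS.
have B0 : 0 <= B by exact: le_trans B1.
have Ti : 0 < (2 * T)^-1 by rewrite invr_gt0 mulr_gt0.
pose K := Sg / (2 * T) * B.
have K0 : 0 <= K by rewrite !mulr_ge0// ltW.
have B22 : 0 <= 22 * B by rewrite mulr_ge0.
have B20 : 0 <= 20 * B by rewrite mulr_ge0.
have K2 : 0 <= K ^+ 2 by exact: sqr_ge0.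
have cK : 0 <= 22 * B * K + 20 * B * K ^+ 2.
  by apply: addr_ge0; apply: mulr_ge0.
exists (22 * B * K + 20 * B * K ^+ 2) => //.
have L1 : 22 * B * K <= 22 * B * K + 20 * B * K ^+ 2.
  by rewrite lerDl; exact: mulr_ge0.
move=> z s /andP[s0 sS].
pose phi a y := s / (2 * T) * dot a y.
have cph a : continuous (phi a) by apply: contM;
  [exact: contC|exact: continuous_dotr].
have phiD a y : S y -> `|phi a y| <= K * enorm a.
  move=> /SB yB; rewrite /phi normrM ger0_norm ?mulr_ge0 ?(ltW Ti)// /K -mulrA.
  rewrite ler_pM ?mulr_ge0 ?(ltW Ti)//; first by rewrite ler_pM2r.
  by rewrite (le_trans (cauchy_schwarz _ _))// mulrC ler_wpM2r ?enorm_ge0.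
have Ka a : 0 <= K * enorm a by rewrite mulr_ge0 ?enorm_ge0.
split=> [a|p].
  apply: (@le_trans _ _ (22 * B * K * enorm a));
    last by rewrite ler_wpM2r ?enorm_ge0.
  rewrite -[_ * K * _]mulrA.
  apply: (pmean_dist (cph a) B0 (Ka a) SB (phiD a)) => y; exact: gexp_shift.
pose m := dot p (pmean z s); pose f y := dot p y - m.
have cf : continuous f by apply: contB; [exact: continuous_dotr|exact: contC].
have cg : continuous (gexp z s) by exact: cont_gexp.
have f0 : avg u0 (gexp z s) f = 0.
  rewrite avgB//; [|exact: continuous_dotr|exact: contC].
  by rewrite avg_cst// -dot_pmean subrr.
have pB y : S y -> `|dot p y| <= enorm p * B.
  by move=> /SB yB; rewrite (le_trans (cauchy_schwarz _ _))// ler_wpM2l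
    ?enorm_ge0.
have mB : `|m| <= enorm p * B.
  by rewrite /m dot_pmean avg_norm_le//; exact: continuous_dotr.
have fB y : S y -> `|f y| <= 2 * (enorm p * B).
  by move=> /pB yB; apply: le_trans (ler_normB _ _) _; lra.
have pB0 : 0 <= 2 * (enorm p * B) by rewrite !mulr_ge0 ?enorm_ge0.
pose q := (s / (2 * T)) *: vavg u0 (gexp z s) f.
have qE a : dot q a = avg u0 (gexp z s) (fun y => f y * phi a y).
  rewrite /q dotZl dotC dot_vavg// -avgZ//; first by apply: eq_avg => y _;
    rewrite /phi mulrCA.
  by apply: contM cf _; exact: continuous_dotr.
exists q.
  apply: (@le_trans _ _ (22 * B * K * enorm p));
    last by rewrite ler_wpM2r ?enorm_ge0.
  apply: enorm_le_dual; first by apply: mulr_ge0 (enorm_ge0 _); exact: mulr_ge0.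
  move=> a; rewrite qE (le_trans (ler_norm _))//.
  apply: (@le_trans _ _ (2 * (enorm p * B) * (K * enorm a))).
    apply: avg_norm_le => //; first exact: contM.
    by move=> y Sy; rewrite normrM ler_pM// ?fB ?phiD.
  have := mulr_ge0 (mulr_ge0 (enorm_ge0 p) B0) (Ka a).
  lra.
move=> a; have -> : dot p (pmean (z + a) s - pmean z s) =
    avg u0 (fun y => gexp z s y + phi a y) f.
  rewrite dotDr dotNr avgB//;
    [|exact: contD|exact: continuous_dotr|exact: contC].
  rewrite avg_cst//; last exact: contD.
  congr (_ - _); rewrite dot_pmean.
  rewrite (_ : gexp (z + a) s = fun y => gexp z s y + phi a y +
    (- ((dot a a + 2 * dot z a) / (4 * T)))).
    by rewrite avg_shift//; [exact: contD|exact: continuous_dotr].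
  by apply/funext => y; exact: gexp_shift.
rewrite qE.
have := avg_tilt_taylor cS cg (cph a) cf pB0 (Ka a) f0 fB (phiD a).
move=> /le_trans; apply.
have : 0 <= 22 * B * K * enorm p * enorm a ^+ 2.
  apply: mulr_ge0 (sqr_ge0 _); apply: mulr_ge0 (enorm_ge0 _).
  exact: mulr_ge0.
nra.
Qed.

End posterior.

(** * The score of the heat flow *)

Section score.
Context {R : realType} {d : nat} (u0 : probability (borelRV R d) R).
Hypothesis (cS : compact (supp u0)).
Implicit Types (x y v a : 'rV[R]_d) (t h : R).
Let S := supp u0.

Lemma derive_of_quadratic (f : 'rV[R]_d -> R) x v (l C delta : R) : 0 < delta ->
  (forall h, `|h| <= delta -> `|f (x + h *: v) - f x - h * l| <= C * h ^+ 2) ->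
  'D_v f x = l.
Proof.
move=> delta0 H; rewrite /derive; apply: (@cvg_lim R^o) => //.
apply/(@cvgrPdist_lt _ R^o) => e e0.
have C0 : 0 < `|C| + 1 by rewrite ltr_wpDl.
have r0 : 0 < Num.min delta (e / (`|C| + 1)) by rewrite lt_min delta0 divr_gt0.
near=> h.
have h0 : h != 0 by near: h; exact: nbhs_dnbhs_neq.
have hr : `|h| < Num.min delta (e / (`|C| + 1)) by near: h; exact: dnbhs0_lt.
have hn : 0 < `|h| by rewrite normr_gt0.
move: hr; rewrite lt_min => /andP[hd he].
rewrite -(@ltr_pM2l _ `|h|)// -normrM.
change (`|h * (l - h^-1 * (f (h *: v + x) - f x))| < `|h| * e).
rewrite mulrBr mulVKf// distrC (addrC (h *: v)).
apply: le_lt_trans (H _ (ltW hd)) _.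
rewrite -[h ^+ 2]real_normK ?num_real// expr2 mulrCA ltr_pM2l//.
apply: (@le_lt_trans _ _ ((`|C| + 1) * `|h|)).
  by rewrite ler_wpM2r// (le_trans (ler_norm _))// lerDl.
by rewrite -ltr_pdivlMl// mulrC.
Unshelve. all: by end_near. Qed.

Lemma Rintegral_setT_supp (f : 'rV[R]_d -> R) (M : R) : continuous f ->
  (forall y, `|f y| <= M) -> Rintegral u0 setT f = sint u0 f.
Proof.
move=> cf fM; rewrite /sint /Rintegral; congr fine.
have mS := supp_measurable u0.
have mSC : measurable (~` S : set (borelRV R d)) by exact: measurableC.
rewrite (@negligible_integral _ _ _ u0 setT (~` S))//.
- by rewrite setTD setCK.
- apply: measurable_bounded_integrable => //.
  + by apply: (@le_lt_trans _ _ 1%E); [exact: probability_le1|exact: ltry].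
  + exact: continuous_measurableRV.
  exists `|M|; split; first exact: num_real.
  by move=> y My z _; apply: le_trans (fM _) (le_trans (ler_norm _) (ltW My)).
exact: suppC_null.
Qed.

Lemma heat_flowE x t : 0 < t -> heat_flow u0 x t =
  (4 * pi * t) `^ (- (d%:R / 2)) * sint u0 (fun y => expR (gexp t x 1 y)).
Proof.
move=> t0; have cg : continuous (fun y => expR (gexp t x 1 y)).
  by apply: cont_expR; exact: cont_gexp.
set c := _ `^ _.
have c0 : 0 <= c by exact: powR_ge0.
transitivity (sint u0 (fun y => c * expR (gexp t x 1 y))); last exact: sintZ.
transitivity (Rintegral u0 setT (fun y => c * expR (gexp t x 1 y))).
  by apply: eq_Rintegral => y _; rewrite /heat_kernel /gexp scale1r.
apply: (@Rintegral_setT_supp _ c); first by apply: contM cg; exact: contC.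
move=> y; rewrite ger0_norm ?mulr_ge0 ?expR_ge0//.
rewrite ler_piMr// -[leRHS]expR0 ler_expR /gexp oppr_le0.
by rewrite divr_ge0 ?sqr_ge0// mulr_ge0// ltW.
Qed.

Lemma ln_ratio (c a b u v : R) : 0 < c -> 0 < a -> 0 < b ->
  u = c * a -> v = c * b -> ln u - ln v = ln (a / b).
Proof.
move=> c0 a0 b0 -> ->; rewrite -ln_div ?posrE ?mulr_gt0//; congr ln.
by rewrite -mulf_div divff ?gt_eqF// mul1r.
Qed.

(** The logarithmic increment of [u] is the logarithm of an exponential
    moment under the posterior, whose second-order expansion yields
    [grad (ln u)] without differentiating under the integral sign. *)
Lemma scoreE x t : 0 < t ->
  score u0 x t = (2 * t)^-1 *: (pmean u0 t x 1 - x).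
Proof.
move=> t0; apply/rowP => i; rewrite /score !mxE.
set m := pmean u0 t x 1.
have [B B1 SB] := supp_bounded cS.
pose v : 'rV[R]_d := delta_mx ord0 i.
have v1 : dot v v = 1 by rewrite dot_deltal mxE !eqxx.
have vn : enorm v = 1.
  by apply/eqP; rewrite -(@eqrXn2 _ 2) ?enorm_ge0// enorm_sqr v1 expr1n.
have ti : 0 < (4 * t)^-1 by rewrite invr_gt0 mulr_gt0.
pose k := (4 * t)^-1 * (1 + 2 * (enorm x + B)).
have B0 : 0 < B by exact: lt_le_trans B1.
have k0 : 0 < k.
  rewrite mulr_gt0// ltr_pwDl// mulr_ge0// addr_ge0 ?enorm_ge0//; exact: ltW.
pose phi h y := - (4 * t)^-1 * (h ^+ 2 + 2 * h * (dot v x - dot v y)).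
have gE h y : gexp t (x + h *: v) 1 y = gexp t x 1 y + phi h y.
  rewrite /gexp /phi !enorm_sqr !dotE v1 !(dotC _ v) ?(dotC y x).
  by field; rewrite gt_eqF.
have cph h : continuous (phi h).
  apply: contM; first exact: contC.
  apply: contD; first exact: contC.
  apply: contM; first exact: contC.
  by apply: contB; [exact: contC|exact: continuous_dotr].
have cg : continuous (gexp t x 1) by exact: cont_gexp.
have phiD h y : `|h| <= 1 -> S y -> `|phi h y| <= k * `|h|.
  move=> h1 /SB yB; rewrite /phi normrM normrN (gtr0_norm ti) /k -[X in _ <=
    X]mulrA.
  rewrite ler_pM2l//.
  have d1 : `|dot v x| <= enorm x.
    by rewrite (le_trans (cauchy_schwarz _ _))// vn mul1r.
  have d2 : `|dot v y| <= B by rewrite (le_trans (cauchy_schwarz _ _))// vn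
    mul1r.
  rewrite (_ : h ^+ 2 + _ = h * (h + 2 * (dot v x - dot v y))); last by ring.
  rewrite normrM mulrC ler_wpM2r//; apply: le_trans (ler_normD _ _) _.
  rewrite lerD// normrM ger0_norm// ler_pM2l//.
  by apply: le_trans (ler_normB _ _) _; exact: lerD.
have fE h : ln (heat_flow u0 (x + h *: v) t) - ln (heat_flow u0 x t) =
    ln (avg u0 (gexp t x 1) (fun y => expR (phi h y))).
  have p0 : 0 < (4 * pi * t) `^ (- (d%:R / 2)).
    by rewrite powR_gt0// !mulr_gt0// pi_gt0.
  have q0 := sint_exp_gt0 cS cg.
  have q1 := sint_exp_gt0 cS (@cont_gexp _ _ t (x + h *: v) 1).
  apply: etrans (ln_ratio p0 q1 q0 (heat_flowE (x + h *: v) t0) (heat_flowE x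
    t0)) _.
  congr ln; rewrite /avg; congr (_ / _).
  by apply: eq_sint => y _; rewrite gE expRD mulrC.
apply: (@derive_of_quadratic _ _ _ _ (10 * k ^+ 2 + (4 * t)^-1)
  (Num.min 1 (4 * k)^-1)).
  by rewrite lt_min ltr01 invr_gt0 mulr_gt0.
move=> h; rewrite le_min => /andP[h1 hk]; rewrite fE.
set D := k * `|h|.
have D0 : 0 <= D by rewrite mulr_ge0// ltW.
have D4 : D <= 1 / 4.
  rewrite /D mulrC -ler_pdivlMr//; apply: le_trans hk _.
  by rewrite invfM mul1r.
pose A := avg u0 (gexp t x 1) (phi h).
have AD : `|A| <= D by apply: avg_norm_le => // y; exact: phiD.
have AE : A = - (4 * t)^-1 * h ^+ 2 + h * ((2 * t)^-1 * (m ord0 i - x ord0 i)).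
  have cvy : continuous (fun y => dot v x - dot v y).
    by apply: contB; [exact: contC|exact: continuous_dotr].
  have chy : continuous (fun y => 2 * h * (dot v x - dot v y)).
    by apply: contM cvy; exact: contC.
  rewrite /A /phi avgZ//; last by apply: contD chy; exact: contC.
  rewrite avgD//; last exact: contC.
  rewrite avg_cst// avgZ// avgB//; [|exact: contC|exact: continuous_dotr].
  rewrite avg_cst// -dot_pmean// -/m /v !dot_deltal.
  by field; rewrite gt_eqF.
set q := avg _ _ _.
have q1 : 1 + A <= q.
  rewrite /q -[X in X + _](avg_cst cS 1 cg) -avgD//; last exact: contC.
  apply: avg_le => //; [by apply: contD; [exact: contC|]|exact: cont_expR|].
  by move=> y _; exact: expR_ge1Dx.
have q2 : q <= 1 + A + 2 * D ^+ 2.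
  have c1 : continuous (fun y => 1 + phi h y) by apply: contD; [exact: contC|].
  rewrite /q -[X in X + _ + _](avg_cst cS 1 cg) -avgD//; last exact: contC.
  rewrite -[X in _ + X](avg_cst cS _ cg) -avgD//; last exact: contC.
  apply: avg_le => //; [exact: cont_expR|by apply: contD; [|exact: contC]|].
  move=> y Sy; have yD := phiD h y h1 Sy; rewrite -/D in yD.
  have : phi h y <= 1 / 2 by apply: le_trans (ler_norm _) _;
    apply: le_trans yD _; lra.
  move=> /expR_taylor1 /andP[_ e2].
  have : phi h y ^+ 2 <= D ^+ 2.
    by rewrite -[leLHS]real_normK ?num_real// ler_pXn2r ?nnegrE.
  lra.
have := AD; rewrite ler_norml => /andP[A1 A2].
have DD : 0 <= D * (1 / 4 - D) by rewrite mulr_ge0// subr_ge0.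
have qw : `|q - 1| <= 2 * D by rewrite ler_norml; apply/andP; split; nra.
have q0 : 1 / 2 <= q by lra.
have qp : 0 < q by lra.
have w2 : (q - 1) ^+ 2 <= 4 * D ^+ 2.
  rewrite -[leLHS]real_normK ?num_real// (_ : 4 * D ^+ 2 = (2 * D) ^+ 2);
    last by ring.
  by rewrite ler_pXn2r ?nnegrE// mulr_ge0.
have l1 : ln q <= q - 1.
  by have := expR_ge1Dx (ln q); rewrite lnK ?posrE//; lra.
have l2 : q - 1 - 2 * (q - 1) ^+ 2 <= ln q.
  have := expR_ge1Dx (- ln q); rewrite expRN lnK ?posrE// => h2.
  have : q - 1 - 2 * (q - 1) ^+ 2 <= 1 - q^-1; last by lra.
  have -> : 1 - q^-1 = (q - 1) / q by field; rewrite gt_eqF.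
  rewrite ler_pdivlMr//.
  have : 0 <= (q - 1) ^+ 2 * (q - 1 / 2) by rewrite mulr_ge0 ?sqr_ge0//
    subr_ge0.
  nra.
have kh : 0 <= (4 * t)^-1 * h ^+ 2 by rewrite mulr_ge0 ?sqr_ge0// ltW.
have DE : D ^+ 2 = k ^+ 2 * h ^+ 2 by rewrite exprMn real_normK ?num_real.
rewrite (_ : h * _ = A + (4 * t)^-1 * h ^+ 2); last by rewrite AE; ring.
have -> : (10 * k ^+ 2 + (4 * t)^-1) * h ^+ 2 = 10 * D ^+ 2 + (4 * t)^-1 * h ^+
  2.
  by rewrite DE; ring.
rewrite ler_norml.
by apply/andP; split; nra.
Qed.

End score.

(** * The regular form of the backward equation *)

Section reparametrization.
Context {R : realType} {d : nat} (u0 : probability (borelRV R d) R) (T : R).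
Hypotheses (T0 : 0 < T) (cS : compact (supp u0)).
Implicit Types (x p : 'rV[R]_d) (s t a b : R).

Lemma pmean_rescale x s : 0 < s ->
  pmean u0 (T / s ^+ 2) x 1 = pmean u0 T (s *: x) s.
Proof.
move=> s0.
transitivity (vavg u0 (gexp (T / s ^+ 2) x 1) (fun=> 1)).
  by rewrite /pmean unlock.
transitivity (vavg u0 (gexp T (s *: x) s) (fun=> 1));
  last by rewrite /pmean unlock.
suff -> : gexp (T / s ^+ 2) x 1 = gexp T (s *: x) s by [].
apply/funext => y.
rewrite /gexp -scalerBr enormZ gtr0_norm// scale1r exprMn; field.
by rewrite !gt_eqF.
Qed.

Lemma is_derive_time s : 0 < s ->
  is_derive s 1 (fun s => T / s ^+ 2) (- (2 * T / s ^+ 3)).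
Proof.
move=> s0.
have d1 : is_derive s 1 (fun s : R => s ^+ 2) (2 * s).
    rewrite (_ : (fun s => s ^+ 2) = id * id); last by apply/funext => r;
      rewrite expr2.
    apply: is_derive_eq (is_deriveM (is_derive_id s (1 : R)) (is_derive_id s (1
      : R))) _.
    by rewrite /GRing.scale/= mulr1 mulr_natl mulr2n.
have s2n : s ^+ 2 != 0 by rewrite gt_eqF// exprn_gt0.
have d2 : is_derive s 1 (fun r : R => (r ^+ 2)^-1) (- ((s ^+ 2) ^- 2) *: (2 *
  s)).
    exact: is_deriveV.
have d3 := is_deriveZ T d2.
apply: is_derive_eq d3 _; rewrite /GRing.scale/=; field.
by rewrite gt_eqF.
Qed.

Lemma is_derive_dot (X : R -> 'rV[R]_d) p t v : is_derive t 1 X v ->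
  is_derive t 1 (fun t => dot p (X t)) (dot p v).
Proof.
move=> [dX XE].
have cv : (h^-1 *: ((X \o shift t) (h *: 1) - X t)) @[h --> 0^'] --> v.
  by rewrite -XE; exact: dX.
have {}cv : (h^-1 *: (((fun t => dot p (X t)) \o shift t) (h *: 1) - dot p (X
  t)))
    @[h --> 0^'] --> (dot p v : R^o).
  apply: (cvg_trans _ (cvg_comp _ _ cv (@continuous_dotr R d p v))).
  apply: near_eq_cvg; near=> h => /=.
  by rewrite dotZr dotDr dotNr.
by split; [apply/cvg_ex; exists (dot p v)|exact: cvg_lim cv].
Unshelve. all: by end_near. Qed.

(** In the variables [s = sqrt (T / t)] and [Z = s X] the backward equation
    becomes the regular equation [Z' = E (Y | Z)] on [s >= 1]. *)
Definition rescaled_solution (xT : 'rV[R]_d) (Z : R -> 'rV[R]_d) :=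
  [/\ Z 1 = xT,
      (forall p s, 1 < s -> is_derive s 1 (fun s => dot p (Z s))
         (dot p (pmean u0 T (Z s) s))) &
      (forall p b, 1 < b -> {within `[1, b],
        continuous (fun s => dot p (Z s))})].

Lemma rescaled_solutionP xT X : backward_solution u0 T xT X ->
  rescaled_solution xT (fun s => s *: X (T / s ^+ 2)).
Proof.
move=> [cX dX XT].
have dZ p s : 1 < s -> is_derive s 1 (fun s => dot p (s *: X (T / s ^+ 2)))
    (dot p (pmean u0 T (s *: X (T / s ^+ 2)) s)).
  move=> s1; have s0 : 0 < s by lra.
  have s20 : 0 < s ^+ 2 by rewrite exprn_gt0.
  have t0 : 0 < T / s ^+ 2 by rewrite divr_gt0.
  have tT : T / s ^+ 2 < T.
    by rewrite ltr_pdivrMr// ltr_pMr// exprn_egt1.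
  have := dX (T / s ^+ 2); rewrite t0 tT => /(_ isT) /(is_derive_dot p).
  rewrite scoreE// pmean_rescale//; set t := T / s ^+ 2.
  set m := pmean _ _ _ _ => dpX.
  have dt := is_derive_time s0.
  have d4 := @is_derive1_comp R (fun t => dot p (X t)) (fun s => T / s ^+ 2) s
    _ _ dpX dt.
  have d5 := is_deriveM (is_derive_id s (1 : R)) d4.
  rewrite (_ : (fun s => _) = id * ((fun t => dot p (X t)) \o (fun s => T / s
    ^+ 2)));
    last by apply/funext => r; rewrite dotZr.
  apply: is_derive_eq d5 _; rewrite /GRing.scale/= -/t mulr1 !dotE /t; field.
  by rewrite !gt_eqF.
split=> [| |p b b1]; first by rewrite scale1r expr1n divr1.
  exact: dZ.
have cts s : 1 < s -> {for s,
  continuous (fun s => dot p (s *: X (T / s ^+ 2)))}.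
  move=> s1; apply: differentiable_continuous; apply/derivable1_diffP.
  by have [] := dZ p s s1.
apply/(@continuous_within_itvP R R R^o 1 b _ b1); split.
- by move=> s; rewrite in_itv/= => /andP[s1 _]; exact: cts.
- have cg : {for (1 : R), continuous (fun s : R => T / s ^+ 2)}.
    apply: differentiable_continuous; apply/derivable1_diffP.
    by have [] := is_derive_time ltr01.
  have cXT : X (T / s ^+ 2) @[s --> 1^'+] --> X (T / 1 ^+ 2).
    have T1 : T / 1 ^+ 2 = T by rewrite expr1n divr1.
    rewrite T1 => U UT.
    have XU : \forall t \near T, `]0, T]%classic t -> U (X t).
      have cT : X @ within `]0, T]%classic (nbhs T) --> X T.
        rewrite (nbhs_subspace_in (A := `]0, T]%classic)); first exact: cX.
        by rewrite /= in_itv/= T0 lexx.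
      exact: cT.
    rewrite -{1}T1 in XU.
    have {}XU := cvg_at_right_filter cg XU.
    change (\forall s \near 1^'+, U (X (T / s ^+ 2))).
    near=> s.
    have s1 : 1 < s by near: s; exact: nbhs_right_gt.
    have : `]0, T]%classic (T / s ^+ 2) -> U (X (T / s ^+ 2)).
      near: s; exact: XU.
    apply; rewrite /= in_itv/= divr_gt0 ?exprn_gt0//; last by lra.
    by rewrite ler_pdivrMr ?exprn_gt0//;
      [rewrite ler_pMr// exprn_ege1// ltW|lra].
  under eq_fun do rewrite dotZr.
  rewrite dotZr.
  apply: cvgM; first exact: cvg_at_right_filter.
  exact: (cvg_comp _ _ cXT (@continuous_dotr R d p _)).
- exact/cvg_at_left_filter/cts.
Unshelve. all: by end_near. Qed.

Lemma rescaled_comparison xT Z p a b (w dw : R -> R) : rescaled_solution xT Z ->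
  1 <= a -> a <= b ->
  (forall s, a < s < b -> is_derive s 1 w (dw s)) ->
  {within `[a, b], continuous w} ->
  (forall s, a < s < b -> dot p (pmean u0 T (Z s) s) <= dw s) ->
  dot p (Z b) - dot p (Z a) <= w b - w a.
Proof.
move=> [_ dZ cZ] a1; rewrite le_eqVlt => /predU1P[-> _ _ _|ab dw' cw le];
  first by rewrite !subrr.
pose g s := dot p (Z s) - w s.
have [] := @MVT R g (fun s => dot p (pmean u0 T (Z s) s) - dw s) a b ab.
- move=> s; rewrite in_itv/= => sab; apply: is_deriveB; last exact: dw'.
  by apply: dZ; case/andP: sab => /(le_lt_trans a1).
- have b1 : 1 < b by exact: le_lt_trans ab.
  have : {within `[a, b], continuous (fun s => dot p (Z s))}.
    apply: continuous_subspaceW (cZ p b b1).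
    by apply: subset_itvr; rewrite bnd_simp.
  move=> cZ' x; apply: (@cvgB _ R^o); [exact: cZ'|exact: cw].
move=> c; rewrite in_itv/= => cab gE.
have : g b - g a <= 0.
  by rewrite gE mulr_le0_ge0// ?subr_le0 ?subr_ge0 ?le// ltW.
rewrite /g; lra.
Qed.

End reparametrization.

(** * Distance to the convex hull *)

Section convex_hulls.
Context {R : realType} {d : nat}.
Implicit Types (A : set 'rV[R]_d) (p x y k : 'rV[R]_d).

Lemma convex_hull_sub A : A `<=` convex_hull A.
Proof. by move=> x Ax B [_]; exact. Qed.

Lemma convex_hull_halfspace A p h : (forall y, A y -> dot p y <= h) ->
  forall y, convex_hull A y -> dot p y <= h.
Proof.
move=> Ah y /(_ [set y | dot p y <= h]); apply;
  split=> // u v l /set_mem/= uh /set_mem/= vh.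
apply/mem_set => /=.
rewrite (_ : conv l u v = l%:num *: u + (1 - l%:num) *: v)// !dotE.
have l0 : 0 <= l%:num by [].
have l1 : 0 <= 1 - l%:num by rewrite subr_ge0.
have := lerD (ler_wpM2l l0 uh) (ler_wpM2l l1 vh); lra.
Qed.

Lemma convex_hull_conv A x y l : 0 <= l <= 1 ->
  convex_hull A x -> convex_hull A y -> convex_hull A (x + l *: (y - x)).
Proof.
move=> /andP[l0 l1] Ax Ay B AB.
have -> : x + l *: (y - x) = l *: y + (1 - l) *: x.
  by rewrite scalerBr scalerBl scale1r addrCA addrA.
exact: (set_mem (AB.1 y x (Itv01 l0 l1) (mem_set (Ay _ AB)) (mem_set (Ax _
  AB)))).
Qed.

(** An almost nearest point of the hull almost satisfies the variational
    inequality of a projection, which spares the compactness of the hull. *)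
Lemma convex_hull_separation A x B : A !=set0 ->
  (forall y, A y -> enorm y <= B) -> forall l, 0 < l <= 1 ->
  exists k, [/\ convex_hull A k, edist_set x (convex_hull A) <= enorm (x - k) &
    forall y, convex_hull A y -> dot (x - k) (y - k) <= l * (1 / 2 + 2 * B ^+
      2)].
Proof.
move=> A0 AB l /andP[l0 l1]; set K := convex_hull A.
have [y0 Ay0] := A0.
have B0 : 0 <= B by exact: le_trans (enorm_ge0 _) (AB _ Ay0).
have KB y : K y -> enorm y <= B.
  move=> Ky; apply: enorm_le_dual => // a.
  rewrite dotC; move: y Ky; apply: convex_hull_halfspace => y /AB yB.
  by rewrite (le_trans (dot_le _ _))// mulrC ler_wpM2r// enorm_ge0.
have K0 : K !=set0 by exists y0; exact: convex_hull_sub.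
set D := edist_set x K.
have D0 : 0 <= D by exact: edist_set_ge0.
have e0 : 0 < Num.sqrt (D ^+ 2 + l ^+ 2) - D.
  rewrite subr_gt0 -{1}(ger0_norm D0) -sqrtr_sqr ltr_sqrt ?ltrDl ?exprn_gt0//.
  by rewrite ltr_wpDl ?sqr_ge0// exprn_gt0.
have [k Kk] := edist_set_adherent x K0 e0; rewrite subrKC => xk.
have Dk y : K y -> D <= enorm (x - y) by exact: edist_set_le.
exists k; split=> // [|y Ky]; first exact: Dk.
have p2 : dot (x - k) (x - k) <= D ^+ 2 + l ^+ 2.
  rewrite -enorm_sqr -[leRHS]sqr_sqrtr ?addr_ge0 ?sqr_ge0//.
  by rewrite ler_pXn2r ?nnegrE ?enorm_ge0 ?sqrtr_ge0// ltW.
have ll : 0 <= l <= 1 by rewrite ltW.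
have : D ^+ 2 <= enorm (x - (k + l *: (y - k))) ^+ 2.
  rewrite ler_pXn2r ?nnegrE ?enorm_ge0//; apply: Dk.
  exact: convex_hull_conv.
rewrite opprD addrA enorm_sqr; move: p2; move: (x - k) => p p2.
have [q qE] : exists q, q = y - k by exists (y - k).
rewrite -qE.
rewrite !dotE (dotC q p) => h.
have qB : dot q q <= 4 * B ^+ 2.
  have q1 : enorm q <= 2 * B.
    by rewrite qE; apply: le_trans (enormD _ _) _; rewrite enormN;
      have := KB _ Ky; have := KB _ Kk; lra.
  rewrite -enorm_sqr (_ : 4 * B ^+ 2 = (2 * B) ^+ 2); last by ring.
  by rewrite ler_pXn2r ?nnegrE ?enorm_ge0 ?mulr_ge0.
have l2q : l ^+ 2 * dot q q <= l ^+ 2 * (4 * B ^+ 2) by rewrite ler_wpM2l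
  ?sqr_ge0.
rewrite -(ler_pM2l l0); nra.
Qed.

End convex_hulls.

Section consequences.
Context {R : realType} {d : nat} (u0 : probability (borelRV R d) R) (T : R).
Hypotheses (T0 : 0 < T) (cS : compact (supp u0)).
Implicit Types (xT p : 'rV[R]_d) (s t a b h : R).
Let S := supp u0.
Let K := convex_hull S.

Lemma dot_pmean_le p z s h : (forall y, S y -> dot p y <= h) ->
  dot p (pmean u0 T z s) <= h.
Proof.
move=> Sh; rewrite dot_pmean//; apply: avg_le_cst => //;
  [exact: cont_gexp|exact: continuous_dotr].
Qed.

Lemma rescaled_affine xT Z p h a b : rescaled_solution u0 T xT Z ->
  1 <= a -> a <= b ->
  (forall s, a < s < b -> dot p (pmean u0 T (Z s) s) <= h) ->
  dot p (Z b - Z a) <= h * (b - a).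
Proof.
move=> sol a1 ab le.
have dw s : is_derive s 1 (fun s => h * s) h.
  have := is_deriveZ h (is_derive_id s (1 : R)).
  by move=> H; apply: is_derive_eq H _; rewrite /GRing.scale/= mulr1.
rewrite dotDr dotNr mulrBr;
  apply: (rescaled_comparison (dw := fun=> h) sol) => //.
apply: derivable_within_continuous => s _; by have [] := dw s.
Qed.

Lemma rescaled_lip xT Z B a b : rescaled_solution u0 T xT Z -> 0 <= B ->
  (forall y, S y -> enorm y <= B) -> 1 <= a -> a <= b ->
  enorm (Z b - Z a) <= B * (b - a).
Proof.
move=> sol B0 SB a1 ab; apply: enorm_le_dual => [|p].
  by rewrite mulr_ge0// subr_ge0.
rewrite dotC (le_trans (rescaled_affine (h := B * enorm p) sol a1 ab _))//.
  move=> s _; apply: dot_pmean_le => y /SB yB.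
  by rewrite (le_trans (dot_le _ _))// mulrC ler_wpM2r ?enorm_ge0.
by rewrite mulrAC.
Qed.

(** Along a solution the signed distance from [Z s] to [s] times a half-space
    containing the support does not increase.  The half-space is chosen almost
    supporting the hull, as seen from the point [s^-1 *: Z s]. *)
Lemma rescaled_hull_dist xT Z s : rescaled_solution u0 T xT Z -> 1 <= s ->
  s * edist_set (s^-1 *: Z s) K <= edist_set xT K.
Proof.
move=> sol s1; have [Z1 _ _] := sol.
have [B B1 SB] := supp_bounded cS.
have s0 : 0 < s by exact: lt_le_trans s1.
have S0 := supp_nonempty u0.
have K0 : K !=set0 by have [y Sy] := S0; exists y; exact: convex_hull_sub.
apply: le_edist_set => // y Ky.
have [x xE] : exists x, x = s^-1 *: Z s by exists (s^-1 *: Z s).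
rewrite -xE; set D := edist_set x K.
have := edist_set_ge0 x K; rewrite -/D le_eqVlt => /predU1P[<-|D0].
  by rewrite mulr0 enorm_ge0.
pose C := 1 / 2 + 2 * B ^+ 2.
have C0 : 0 < C by rewrite ltr_wpDr ?mulr_ge0 ?sqr_ge0//; lra.
apply/ler_addgt0Pr => e e0.
(* with this [l] the defect of the separation costs at most [e] *)
pose l := Num.min 1 (e * D / (s * C)).
have l0 : 0 < l by rewrite lt_min ltr01 divr_gt0// mulr_gt0.
have l1 : l <= 1 by rewrite ge_min lexx.
have lC : s * (l * C) <= e * D.
  have : l <= e * D / (s * C) by rewrite ge_min lexx orbT.
  by rewrite ler_pdivlMr ?mulr_gt0// mulrCA.
have ll : 0 < l <= 1 by rewrite l0.
have [k [Kk Dk sep]] := convex_hull_separation x S0 SB ll.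
rewrite -/C -/D in sep Dk.
have [p pE] : exists p, p = x - k by exists (x - k).
rewrite -pE in sep Dk.
pose h := dot p k + l * C.
have ph y' : K y' -> dot p y' <= h.
  by move=> /sep; rewrite dotDr dotNr /h; lra.
have := @rescaled_affine xT Z p h 1 s sol (lexx _) s1.
have Sh y' : S y' -> dot p y' <= h by move=> /convex_hull_sub; exact: ph.
move=> /(_ (fun r _ => dot_pmean_le _ _ Sh)); rewrite Z1.
have -> : Z s = s *: x by rewrite xE scalerA divff ?scale1r// gt_eqF.
rewrite !dotE => hs.
have px : dot p x = enorm p ^+ 2 + dot p k.
  by rewrite enorm_sqr -dotDr pE subrK.
have py : dot p xT - dot p y <= enorm p * enorm (xT - y).
  by rewrite -dotNr -dotDr dot_le.
have pp : 0 < enorm p by exact: lt_le_trans Dk.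
have hy := ph _ Ky.
have main : s * enorm p ^+ 2 <= enorm p * enorm (xT - y) + s * (l * C).
  by rewrite px in hs; rewrite /h in hs hy; nra.
rewrite -(ler_pM2l pp).
apply: (@le_trans _ _ (s * enorm p ^+ 2)).
  by rewrite mulrCA ler_pM2l// expr2 ler_pM2l.
apply: le_trans main _; rewrite (mulrDr (enorm p)) lerD2l; apply: le_trans lC _.
by rewrite mulrC ler_pM2r.
Qed.

End consequences.

(** * Semiconvex functions and the Euler scheme *)

Section semiconvex.
Context {R : realType} {d : nat}.
Implicit Types (A : set 'rV[R]_d) (x z a p q : 'rV[R]_d) (g : 'rV[R]_d -> R).
Implicit Types (c L h eta rho : R).

(** [g] lies, up to an arbitrarily small error, above a downward paraboloid
    of curvature [c] and slope at most [c] at each point.  The error makes the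
    notion stable under suprema. *)
Definition semiconvex c g := forall x eta, 0 < eta ->
  exists2 p, enorm p <= c &
    forall a, g x + dot p a - c * enorm a ^+ 2 - eta <= g (x + a).

Lemma semiconvex_lip c g x a : 0 <= c -> semiconvex c g -> enorm a <= 1 ->
  `|g (x + a) - g x| <= 2 * c * enorm a.
Proof.
move=> c0 gc a1.
have low z b : g z - c * enorm b - c * enorm b ^+ 2 <= g (z + b).
  apply/ler_addgt0Pr => e e0; have [p pc /(_ b) h] := gc z e e0.
  have := dot_le p (- b); rewrite dotNr enormN => h1.
  have : enorm p * enorm b <= c * enorm b by rewrite ler_wpM2r ?enorm_ge0.
  lra.
have h1 := low x a.
have := low (x + a) (- a); rewrite addrK enormN => h2.
have h3 : c * enorm a ^+ 2 <= c * enorm a.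
  by rewrite ler_wpM2l// expr2 ler_piMr ?enorm_ge0.
by rewrite ler_norml; apply/andP; split; lra.
Qed.

Lemma semiconvex_continuous c g : 0 <= c -> semiconvex c g -> continuous g.
Proof.
move=> c0 gc; apply: continuous_of_modulus => x; exists (2 * c) => a.
exact: semiconvex_lip.
Qed.

(** Where the composed map has an approximate differential with transpose
    [p |-> q], slopes are pulled back by the transpose. *)
Lemma semiconvex_comp c g (F : 'rV[R]_d -> 'rV[R]_d) L h : 0 <= c -> 0 <= L ->
  0 <= h <= 1 -> semiconvex c g ->
  (forall z a, enorm (F (z + a) - F z) <= (1 + L * h) * enorm a) ->
  (forall z p, exists2 q, enorm q <= (1 + L * h) * enorm p & forall a,
     `|dot p (F (z + a) - F z) - dot q a| <= L * h * enorm p * enorm a ^+ 2) ->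
  semiconvex (c * (1 + (3 * L + L ^+ 2) * h)) (g \o F).
Proof.
move=> c0 L0 /andP[h0 h1] gc Flip Fdiff z eta eta0.
have [p pc gp] := gc (F z) eta eta0; have [q qp Fq] := Fdiff z p.
have Lh : 0 <= L * h by exact: mulr_ge0.
have LLh : L * h * (L * h) <= L ^+ 2 * h.
  have : 0 <= L ^+ 2 * h * (1 - h) by rewrite !mulr_ge0 ?sqr_ge0// subr_ge0.
  nra.
exists q => [|a].
  apply: le_trans qp _; apply: (@le_trans _ _ ((1 + L * h) * c)).
    by rewrite ler_wpM2l// addr_ge0.
  rewrite mulrC ler_wpM2l// lerD2l mulrDl.
  have : 0 <= L ^+ 2 * h by rewrite mulr_ge0// sqr_ge0.
  lra.
have := gp (F (z + a) - F z); rewrite subrKC => /= h2.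
have := Fq a; rewrite ler_norml => /andP[h3 _].
have na : 0 <= enorm a ^+ 2 by exact: sqr_ge0.
have h4 : enorm (F (z + a) - F z) ^+ 2 <= (1 + L * h) ^+ 2 * enorm a ^+ 2.
  rewrite -exprMn ler_pXn2r ?nnegrE ?enorm_ge0 ?mulr_ge0 ?enorm_ge0 ?addr_ge0//.
have h5 : c * enorm (F (z + a) - F z) ^+ 2 <=
    c * ((1 + L * h) ^+ 2 * enorm a ^+ 2) by rewrite ler_wpM2l.
have h6 : L * h * enorm p * enorm a ^+ 2 <= L * h * c * enorm a ^+ 2.
  by rewrite ler_wpM2r// ler_wpM2l.
have h7 : c * ((1 + L * h) ^+ 2 * enorm a ^+ 2) + L * h * c * enorm a ^+ 2 <=
    c * (1 + (3 * L + L ^+ 2) * h) * enorm a ^+ 2.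
  rewrite -subr_ge0 (_ : _ - _ = c * enorm a ^+ 2 * (L ^+ 2 * h - L * h * (L *
    h)));
    last by ring.
  by rewrite mulr_ge0 ?subr_ge0// mulr_ge0.
lra.
Qed.

(** A supremum of downward paraboloids: it is semiconvex with constants that
    do not depend on [A], which may be any set.  The value 0 makes it
    nonnegative, and keeps the supremum meaningful when [A] is empty. *)
Definition bump A rho x : R :=
  sup ([set 0] `|` [set 1 - enorm (x - z) ^+ 2 / rho ^+ 2 | z in A]).

Lemma bump_has_sup A rho x :
  has_sup ([set 0] `|` [set 1 - enorm (x - z) ^+ 2 / rho ^+ 2 | z in A]).
Proof.
split; first by exists 0; left.
exists 1 => _ [->|[z _ <-]]; first exact: ler01.
by rewrite lerBlDr lerDl divr_ge0 ?sqr_ge0.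
Qed.

Lemma bump_ge0 A rho x : 0 <= bump A rho x.
Proof. by apply: (ub_le_sup (bump_has_sup A rho x).2); left. Qed.

Lemma bump_le1 A rho x : bump A rho x <= 1.
Proof.
apply: ge_sup; first exact: (bump_has_sup A rho x).1.
move=> _ [->|[z _ <-]]; first exact: ler01.
by rewrite lerBlDr lerDl divr_ge0 ?sqr_ge0.
Qed.

Lemma bump_eq1 A rho x : A x -> bump A rho x = 1.
Proof.
move=> Ax; apply/eqP; rewrite eq_le bump_le1/=.
apply: (ub_le_sup (bump_has_sup A rho x).2); right; exists x => //.
by rewrite subrr enorm0 expr0n mul0r subr0.
Qed.

Lemma bump_eq0 A rho x : 0 < rho -> (forall z, A z -> rho <= enorm (x - z)) ->
  bump A rho x = 0.
Proof.
move=> r0 Ar; apply/eqP; rewrite eq_le bump_ge0 andbT.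
apply: ge_sup; first exact: (bump_has_sup A rho x).1.
move=> _ [->//|[z /Ar zr <-]]; rewrite subr_le0 ler_pdivlMr ?exprn_gt0// mul1r.
by rewrite ler_pXn2r ?nnegrE ?enorm_ge0// ltW.
Qed.

Lemma bump_semiconvex A rho : 0 < rho ->
  semiconvex (2 / rho + rho ^- 2) (bump A rho).
Proof.
move=> r0; have r20 : 0 < rho ^+ 2 by rewrite exprn_gt0.
set c := 2 / rho + _.
have c1 : 2 / rho <= c by rewrite lerDl invr_ge0 ltW.
have c2 : rho ^- 2 <= c by rewrite lerDr divr_ge0// ltW.
have c0 : 0 <= c by rewrite (le_trans _ c1)// divr_ge0// ltW.
move=> x eta eta0.
have [v Ev vx] := sup_adherent eta0 (bump_has_sup A rho x).
rewrite -/(bump A rho x) in vx.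
have [v0|v0] := lerP v 0.
  exists 0; first by rewrite enorm0.
  move=> a; rewrite dot0l; have := bump_ge0 A rho (x + a).
  have : 0 <= c * enorm a ^+ 2 by rewrite mulr_ge0 ?sqr_ge0.
  lra.
case: Ev => [v00|[z Az vE]]; first by move: v0; rewrite v00 ltxx.
have xz : enorm (x - z) <= rho.
  rewrite -(@ler_pXn2r _ 2)// ?nnegrE ?enorm_ge0 ?(ltW r0)//.
  by move: v0; rewrite -vE subr_gt0 ltr_pdivrMr// mul1r => /ltW.
exists ((- 2 / rho ^+ 2) *: (x - z)).
  apply: le_trans c1; rewrite enormZ (_ : `|- 2 / rho ^+ 2| = 2 / rho ^+ 2);
    last first.
    by rewrite normrM normrN !ger0_norm// invr_ge0 ltW.
  rewrite expr2 invfM mulrA -[X in _ <= X]mulr1 -!mulrA.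
  rewrite !ler_pM2l ?invr_gt0// mulrC ler_pdivrMr// mul1r//.
move=> a; have ha : 0 <= enorm a ^+ 2 by exact: sqr_ge0.
have h1 : 1 - enorm (x + a - z) ^+ 2 / rho ^+ 2 <= bump A rho (x + a).
  by apply: (ub_le_sup (bump_has_sup A rho (x + a)).2); right; exists z.
have h2 : rho ^- 2 * enorm a ^+ 2 <= c * enorm a ^+ 2 by rewrite ler_wpM2r.
apply: le_trans h1; have -> : x + a - z = (x - z) + a by rewrite addrAC.
move: vE h2 xz.
move: (x - z) => w vE h2 xz.
rewrite !enorm_sqr in vE h2 *; rewrite !dotE (dotC a w).
have -> : 1 - (dot w w + dot w a + (dot w a + dot a a)) / rho ^+ 2 =
    v - 2 / rho ^+ 2 * dot w a - rho ^- 2 * dot a a by rewrite -vE; ring.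
by rewrite !mulNr; lra.
Qed.

End semiconvex.

Section euler.
Context {R : realType} {d : nat} (u0 : probability (borelRV R d) R) (T : R).
Hypotheses (T0 : 0 < T) (cS : compact (supp u0)).
Implicit Types (xT p z a : 'rV[R]_d) (g : 'rV[R]_d -> R) (s h c L Sg : R).
Let S := supp u0.

Definition euler h s z : 'rV[R]_d := z + h *: pmean u0 T z s.

Fixpoint euler_steps h m s z : 'rV[R]_d :=
  if m is m'.+1 then euler_steps h m' (s + h) (euler h s z) else z.

Lemma exprn_le_expR (x : R) m : 0 <= x -> (1 + x) ^+ m <= expR (m%:R * x).
Proof.
move=> x0; rewrite expRM_natl lerXn2r ?nnegrE ?addr_ge0 ?expR_ge0//.
exact: expR_ge1Dx.
Qed.

(** Precomposition with the Euler map costs a factor [1 + K h] in the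
    semiconvexity constant, so that any number of steps covering [1, Sg]
    costs at most [exp (K Sg)]. *)
Lemma euler_semiconvex Sg : 0 <= Sg -> exists2 K, 0 <= K &
  forall s h c g, 0 <= s <= Sg -> 0 <= h <= 1 -> 0 <= c -> semiconvex c g ->
    semiconvex (c * (1 + K * h)) (g \o euler h s).
Proof.
move=> /(pmean_taylor T0 cS)[L L0 HL]; exists (3 * L + L ^+ 2).
  by rewrite addr_ge0 ?mulr_ge0 ?sqr_ge0.
move=> s h c g sS hh c0 gc; have /andP[h0 h1] := hh.
have eE z a : euler h s (z + a) - euler h s z =
    a + h *: (pmean u0 T (z + a) s - pmean u0 T z s).
  by apply/rowP => i; rewrite !mxE; ring.
apply: semiconvex_comp => //.
- move=> z a; rewrite eE (le_trans (enormD _ _))// mulrDl mul1r lerD2l.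
  rewrite enormZ ger0_norm// (mulrC L) -mulrA ler_wpM2l//.
  by have [+ _] := HL z s sS; apply.
move=> z p; have [_ /(_ p)[q qp Hq]] := HL z s sS.
exists (p + h *: q).
  rewrite (le_trans (enormD _ _))// mulrDl mul1r lerD2l.
  by rewrite enormZ ger0_norm// (mulrC L) -mulrA ler_wpM2l.
move=> a; rewrite eE; move: (Hq a).
move: (pmean u0 T (z + a) s - pmean u0 T z s) => w {}Hq.
rewrite (_ : _ - _ = h * (dot p w - dot q a)); last first.
  by rewrite !dotDl !dotDr !dotZl !dotZr; ring.
by rewrite normrM ger0_norm// (mulrC L) -!mulrA ler_wpM2l// mulrA.
Qed.

(** The local error is quadratic since [Z] and the posterior mean are
    Lipschitz. *)
Lemma euler_local xT Z Sg : rescaled_solution u0 T xT Z -> 1 <= Sg ->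
  exists2 C, 0 <= C & forall s h, 1 <= s -> 0 <= h -> s + h <= Sg ->
    enorm (euler h s (Z s) - Z (s + h)) <= C * h ^+ 2.
Proof.
move=> sol Sg1; have [B B1 SB] := supp_bounded cS.
have B0 : 0 <= B by exact: le_trans B1.
have Sg0 : 0 <= Sg by exact: le_trans Sg1.
have rho0 : 0 <= enorm xT + B * Sg by rewrite addr_ge0 ?enorm_ge0 ?mulr_ge0.
have [L L0 HL] := pmean_lip T0 cS rho0 Sg0.
exists (L * (B + 1)); first by rewrite mulr_ge0// addr_ge0.
move=> s h s1 h0 shS; have [Z1 _ _] := sol.
have Zs : enorm (Z s) <= enorm xT + B * Sg.
  have := rescaled_lip cS sol B0 SB (lexx _) s1; rewrite Z1 => h1.
  have := enormD (Z s - xT) xT; rewrite subrK => h2.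
  have : B * (s - 1) <= B * Sg by rewrite ler_wpM2l//; lra.
  lra.
have key p : dot p (Z (s + h) - Z s) <=
    (dot p (pmean u0 T (Z s) s) + enorm p * (L * (B + 1) * h)) * h.
  rewrite [X in _ * X](_ : h = (s + h) - s); last by ring.
  apply: (rescaled_affine sol) => //; first by rewrite lerDl.
  move=> r /andP[sr rh]; rewrite -lerBlDl -dotNr -dotDr.
  apply: le_trans (dot_le _ _) _; rewrite ler_wpM2l ?enorm_ge0//.
  have s0S : 0 <= s <= Sg by apply/andP; split; lra.
  have r0S : 0 <= r <= Sg by apply/andP; split; lra.
  apply: le_trans (HL _ _ (Z r) r Zs s0S r0S) _.
  rewrite -mulrA ler_wpM2l//.
  have := rescaled_lip cS sol B0 SB s1 (ltW sr).
  have : B * (r - s) <= B * h by rewrite ler_wpM2l//; lra.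
  by rewrite gtr0_norm ?subr_gt0//; lra.
rewrite enormB; apply: enorm_le_dual;
  first by rewrite !mulr_ge0 ?sqr_ge0// addr_ge0.
move=> p; rewrite dotC /euler opprD addrA dotDr dotNr dotZr.
have := key p; lra.
Qed.

Lemma euler_steps_dist xT Z Sg : rescaled_solution u0 T xT Z -> 1 <= Sg ->
  exists2 C, 0 <= C & exists2 L, 0 <= L & forall h m s z, 0 <= h -> 1 <= s ->
    s + m%:R * h <= Sg ->
    enorm (euler_steps h m s z - Z (s + m%:R * h)) <=
      (1 + L * h) ^+ m * (enorm (z - Z s) + m%:R * (C * h ^+ 2)).
Proof.
move=> sol Sg1; have [C C0 HC] := euler_local sol Sg1.
have Sg0 : 0 <= Sg by exact: le_trans Sg1.
have [L L0 HL] := pmean_taylor T0 cS Sg0.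
exists C => //; exists L => // h m.
elim: m => [|m IH] s z h0 s1 sS /=.
  by rewrite expr0 mul1r !mul0r !addr0.
have mh : 0 <= m%:R * h by rewrite mulr_ge0.
have sE : s + m.+1%:R * h = s + h + m%:R * h.
  by rewrite -natr1; ring.
rewrite sE in sS *.
have s1' : 1 <= s + h by lra.
apply: le_trans (IH (s + h) _ h0 s1' sS) _.
have Lh : 1 <= 1 + L * h by rewrite lerDl mulr_ge0.
rewrite [(1 + L * h) ^+ m.+1]exprSr -[leRHS]mulrA; apply: ler_wpM2l;
  first by rewrite exprn_ge0// (le_trans ler01).
have shS : s + h <= Sg by lra.
have e1 := HC s h s1 h0 shS.
have e2 : enorm (euler h s z - euler h s (Z s)) <= (1 + L * h) * enorm (z - Z
  s).
  have -> : euler h s z - euler h s (Z s) =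
      (z - Z s) + h *: (pmean u0 T z s - pmean u0 T (Z s) s).
    by rewrite /euler scalerBr opprD addrACA.
  rewrite (le_trans (enormD _ _))// mulrDl mul1r lerD2l.
  rewrite enormZ ger0_norm// (mulrC L) -mulrA ler_wpM2l//.
  have sS' : 0 <= s <= Sg by apply/andP; split; lra.
  have [+ _] := HL (Z s) s sS' => /(_ (z - Z s)).
  by rewrite subrKC.
have e3 := enorm_triangle (euler h s (Z s)) (euler h s z) (Z (s + h)).
have C2 : 0 <= C * h ^+ 2 by rewrite mulr_ge0 ?sqr_ge0.
have : m%:R * (C * h ^+ 2) + C * h ^+ 2 <=
    (1 + L * h) * (m.+1%:R * (C * h ^+ 2)).
  have -> : m%:R * (C * h ^+ 2) + C * h ^+ 2 = m.+1%:R * (C * h ^+ 2).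
    by rewrite -natr1 mulrDl mul1r.
  by rewrite -[leLHS]mul1r ler_wpM2r// mulr_ge0.
rewrite (mulrDr (1 + L * h)); lra.
Qed.

(** Convergence of the Euler scheme to any solution; in particular a solution
    is determined by its terminal value. *)
Lemma euler_cvg xT Z Sg : rescaled_solution u0 T xT Z -> 1 <= Sg ->
  exists2 C, 0 <= C & forall n, (0 < n)%N ->
    enorm (euler_steps ((Sg - 1) / n%:R) n 1 xT - Z Sg) <= C / n%:R.
Proof.
move=> sol Sg1; have [C C0 [L L0 HCL]] := euler_steps_dist sol Sg1.
have [Z1 _ _] := sol.
exists (expR (L * (Sg - 1)) * (C * (Sg - 1) ^+ 2)).
  by apply: mulr_ge0 (expR_ge0 _) (mulr_ge0 C0 (sqr_ge0 _)).
move=> n n0; have nR : 0 < n%:R :> R by rewrite ltr0n.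
set h := (Sg - 1) / n%:R.
have h0 : 0 <= h by rewrite divr_ge0// subr_ge0.
have nh : n%:R * h = Sg - 1 by rewrite mulrC divfK// gt_eqF.
have SE : 1 + n%:R * h = Sg by rewrite nh subrKC.
have := HCL h n 1 xT h0 (lexx _); rewrite SE => /(_ (lexx _)).
rewrite Z1 subrr enorm0 add0r => /le_trans; apply.
rewrite -mulrA; apply: ler_pM.
- by rewrite exprn_ge0// addr_ge0// mulr_ge0.
- by rewrite mulr_ge0// mulr_ge0 ?sqr_ge0.
- apply: le_trans (exprn_le_expR _ (mulr_ge0 L0 h0)) _.
  by rewrite mulrCA nh.
rewrite le_eqVlt; apply/orP; left; apply/eqP; rewrite /h; field.
by rewrite gt_eqF.
Qed.

End euler.

(** * Translation invariance of Lebesgue measure *)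

Section translation.
Context {R : realType}.
Local Notation mR := (measurableTypeR R).
Local Notation leb := (@lebesgue_measure R).
Implicit Types (a x : R).

Definition translate a : R -> mR := fun x => x + a.

Lemma measurable_translate a : measurable_fun setT (translate a).
Proof. exact: measurable_funD. Qed.

Lemma lebesgue_translate a (A : set R) : measurable A ->
  pushforward leb (translate a) A = leb A.
Proof.
move=> mA; apply/esym/lebesgue_measure_unique => //=.
  exact: measurable_translate.
move=> _ X [[b c] _ <-].
rewrite /pushforward (_ : _ @^-1` _ = `]b - a, c - a]%classic); last first.
  by apply/seteqP; split=> x; rewrite /translate /= !in_itv/= ltrBlDr lerBrDr.
rewrite !lebesgue_measure_itv/= !lte_fin ltrD2r.
by case: ifP => // _; rewrite -!EFinB; congr EFin; ring.
Qed.

Lemma integral_translate a (f : mR -> \bar R) : measurable_fun setT f ->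
  (forall x, 0 <= f x)%E -> (\int[leb]_x f (x + a)%R = \int[leb]_x f x)%E.
Proof.
move=> mf f0.
transitivity (\int[pushforward leb (translate a)]_x f x)%E.
  by rewrite ge0_integral_pushforward// ?preimage_setT;
    exact: measurable_translate.
apply: eq_measure_integral => /=.
  exact: measurable_translate.
by move=> ? A mA _; exact: lebesgue_translate.
Qed.

End translation.

Section tuples.
Context {R : realType}.
Local Notation mR := (measurableTypeR R).
Local Notation leb := (@lebesgue_measure R).
Local Notation lam n := (tuple_measure (@lebesgue_measure R) n).

Lemma integral_tuple_cons n (f : n.+1.-tuple mR -> \bar R) :
  measurable_fun setT f -> (forall t, 0 <= f t)%E ->
  (\int[lam n.+1]_t f t = \int[leb]_x \int[lam n]_t f (cons_pair (x, t)))%E.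
Proof.
move=> mf f0.
have mc : measurable_fun setT (@cons_pair _ mR n) by exact: measurable_cons.
transitivity (\int[(leb \x lam n)%E]_p (f \o @cons_pair _ mR n) p)%E.
  have := @ge0_integral_pushforward _ _ _ _ R _ mc (leb \x lam n)%E setT f
    measurableT mf (fun t _ => f0 t).
  by rewrite preimage_setT.
rewrite fubini_tonelli1//.
  exact: measurableT_comp.
by move=> p; exact: f0.
Qed.

Definition tuple_translate n (a t : n.-tuple mR) : n.-tuple mR :=
  [tuple tnth t i + tnth a i | i < n].

Lemma measurable_tuple_translate n (a : n.-tuple mR) :
  measurable_fun setT (tuple_translate a).
Proof.
apply/measurable_fun_tnthP => i.
rewrite (_ : _ \o _ = fun t : n.-tuple mR => tnth t i + tnth a i); last first.
  by apply/funext => t /=; rewrite tnth_mktuple.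
by apply: measurable_funD => //; exact: measurable_tnth.
Qed.

(** Induction on the dimension, by Tonelli's theorem. *)
Lemma integral_tuple_translate n (a : n.-tuple mR) (f : n.-tuple mR -> \bar R) :
  measurable_fun setT f -> (forall t, 0 <= f t)%E ->
  (\int[lam n]_t f (tuple_translate a t) = \int[lam n]_t f t)%E.
Proof.
elim: n a f => [|n IH] a f mf f0.
  by apply: eq_integral => t _; congr f; rewrite (tuple0 t) tuple0.
case/tupleP: a => a0 a'; set a : n.+1.-tuple mR := [tuple of a0 :: a'].
have mfa : measurable_fun setT (f \o tuple_translate a).
  by apply: measurableT_comp mf _; exact: measurable_tuple_translate.
have mfx x : measurable_fun setT (fun t : n.-tuple mR => f (cons_pair (x, t))).
  apply: measurableT_comp mf _.
  by apply: measurable_cons; [exact: measurable_cst|exact: measurable_id].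
rewrite (integral_tuple_cons mf f0).
transitivity (\int[leb]_x \int[lam n]_t f (tuple_translate a (cons_pair (x,
  t))))%E.
  by apply: (integral_tuple_cons mfa) => t; exact: f0.
pose F x := (\int[lam n]_t f (cons_pair (x, t)))%E.
transitivity (\int[leb]_x F (x + a0)%R)%E.
  apply: eq_integral => x _; rewrite /F -[RHS](IH a')//.
  apply: eq_integral => t _ /=; congr f; apply: eq_from_tnth => i.
  rewrite tnth_mktuple; case: (unliftP ord0 i) => [j ->|->].
    by rewrite !tnthS/= tnth_mktuple.
  by rewrite !tnth0.
apply: integral_translate => [|x]; last by apply: integral_ge0 => t _;
  exact: f0.
apply: (measurable_fun_fubini_tonelli_F (m2 := lam n) (fun p => f (cons_pair
  p))).
  by apply: measurableT_comp mf _; exact: measurable_cons.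
by move=> p; exact: f0.
Qed.

End tuples.

(** * Joint laws of signal and observation *)

Section gaussian_mass.
Context {R : realType}.
Local Notation mR := (measurableTypeR R).
Local Notation leb := (@lebesgue_measure R).
Local Notation lam n := (tuple_measure (@lebesgue_measure R) n).

Lemma gauss1_lty (k : R) : 0 < k ->
  (\int[leb]_x (expR (- (k * x ^+ 2)))%:E < +oo)%E.
Proof.
move=> k0; pose s := Num.sqrt (2 * k)^-1.
have s2 : s ^+ 2 = (2 * k)^-1 by rewrite sqr_sqrtr// invr_ge0 mulr_ge0// ltW.
have s0 : s != 0 by rewrite -sqrf_eq0 s2 invr_eq0 mulf_neq0// gt_eqF.
have p0 : 0 < normal_peak s by exact: normal_peak_gt0.
have := integral_normal_pdf (0 : R) s.
rewrite normal_pdfE// => I1.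
have E : (fun x : R => (expR (- (k * x ^+ 2)))%:E) =
    fun x => ((normal_peak s)^-1%:E * (normal_peak s * normal_fun 0 s x)%:E)%E.
  apply/funext => x; rewrite -EFinM mulKf ?gt_eqF//; congr (expR _)%:E.
  by rewrite subr0 s2 -mulr_natr mulNr; congr (- _); field; rewrite gt_eqF.
rewrite E ge0_integralZl//=.
- by rewrite I1 mule1 ltry.
- apply/measurable_EFinP; apply: measurable_funM => //.
  exact: measurable_normal_fun.
- by move=> x _; rewrite lee_fin mulr_ge0 ?(ltW p0)// normal_fun_ge0.
- by rewrite lee_fin invr_ge0 ltW.
Qed.

Lemma measurable_sum_sqr n : measurable_fun setT
  (fun t : n.-tuple mR => \sum_(i < n) (tnth t i) ^+ 2).
Proof.
apply: measurable_sum => i; apply: measurable_funX; exact: measurable_tnth.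
Qed.

Lemma gauss_tuple_lty n (k : R) : 0 < k ->
  (\int[lam n]_t (expR (- (k * \sum_(i < n) (tnth t i) ^+ 2)))%:E < +oo)%E.
Proof.
move=> k0.
have mG m : measurable_fun setT (fun t : m.-tuple mR =>
    (expR (- (k * \sum_(i < m) (tnth t i) ^+ 2)))%:E).
  apply/measurable_EFinP; apply: measurableT_comp => //.
  apply: measurableT_comp => //; apply: measurable_funM => //.
  exact: measurable_sum_sqr.
elim: n => [|n IH].
  rewrite [ltLHS](_ : _ = 1%E) ?ltry//.
  under eq_integral do rewrite big_ord0 mulr0 oppr0 expR0.
  by rewrite integral_cst// mul1e/= diracT.
pose E m (t : m.-tuple mR) := (expR (- (k * \sum_(i < m) (tnth t i) ^+ 2)))%:E.
have E0 m t : (0 <= E m t)%E by rewrite lee_fin expR_ge0.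
pose C := (\int[lam n]_t E n t)%E.
have C0 : (0 <= C)%E by apply: integral_ge0 => t _; exact: E0.
have EE x t : E n.+1 (cons_pair (x,
  t)) = ((expR (- (k * x ^+ 2)))%:E * E n t)%E.
  rewrite /E big_ord_recl tnth0 mulrDr opprD expRD EFinM.
  by under eq_bigr do rewrite tnthS.
have -> : (\int[lam n.+1]_t E n.+1 t =
    \int[leb]_x ((expR (- (k * x ^+ 2)))%:E * C))%E.
  apply: etrans (integral_tuple_cons (mG n.+1) (@E0 n.+1)) _.
  apply: eq_integral => x _; rewrite /C -ge0_integralZl//.
  - by apply: eq_integral => t _; exact: EE.
  - exact: mG.
rewrite ge0_integralZr//.
- apply: lte_mul_pinfty; [|rewrite ge0_fin_numE|exact: IH].
  + by apply: integral_ge0 => x _; rewrite lee_fin expR_ge0.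
  + exact: gauss1_lty.
  + by apply: integral_ge0 => x _; rewrite lee_fin expR_ge0.
- apply/measurable_EFinP; apply: measurableT_comp => //.
  by apply: measurableT_comp => //; apply: measurable_funM => //;
    exact: measurable_funX.
Qed.

End gaussian_mass.

Section joint_law.
Context {R : realType} {d : nat} (u0 : probability (borelRV R d) R) (T : R).
Hypotheses (T0 : 0 < T) (cS : compact (supp u0)).
Local Notation mR := (measurableTypeR R).
Local Notation lam := (tuple_measure (@lebesgue_measure R) d).
Local Notation V := 'rV[R]_d.
Implicit Types (y z : V) (s h c : R) (f g : V -> R) (t : d.-tuple mR).
Let S := supp u0.

Lemma measurable_coordRV i : measurable_fun setT (fun z : borelRV R d => z ord0
  i : R).
Proof. by apply: continuous_measurableRV; exact: coord_continuous. Qed.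

Lemma measurable_shift_pair h : measurable_fun setT
  (fun p : borelRV R d * borelRV R d => (p.1 + h *: p.2 : V) : borelRV R d).
Proof.
pose F (p : borelRV R d * borelRV R d) : d.-tuple mR :=
  [tuple (p.1 : V) ord0 i + h * (p.2 : V) ord0 i | i < d].
have mF : measurable_fun setT F.
  apply/measurable_fun_tnthP => i.
  rewrite (_ : _ \o _ = fun p => (p.1 : V) ord0 i + h * (p.2 : V) ord0 i);
    last first.
    by apply/funext => p /=; rewrite tnth_mktuple.
  apply: measurable_funD.
    by apply: measurableT_comp (measurable_coordRV i) _; exact: measurable_fst.
  apply: measurable_funM => //.
  by apply: measurableT_comp (measurable_coordRV i) _; exact: measurable_snd.
rewrite (_ : (fun p => _) = @row_of_tuple R d \o F); last first.
  by apply/funext => p; apply/rowP => i; rewrite !mxE tnth_mktuple.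
exact: measurableT_comp.
Qed.

Lemma row_of_tuple_translate y h t :
  row_of_tuple (tuple_translate [tuple h * y ord0 i | i < d] t) =
  row_of_tuple t + h *: y :> V.
Proof. by apply/rowP => i; rewrite !mxE !tnth_mktuple. Qed.

Lemma gexp_translate z y s h : gexp T (z + h *: y) (s + h) y = gexp T z s y.
Proof. by rewrite /gexp scalerDl opprD addrACA subrr addr0. Qed.

Lemma sint_integral f : continuous f -> (forall y, 0 <= f y) ->
  (\int[u0]_y (f y)%:E = (sint u0 f)%:E)%E.
Proof.
move=> cf f0.
have mS := supp_measurable u0.
have mSC : measurable (~` S : set (borelRV R d)) by exact: measurableC.
have mf : measurable_fun setT (EFin \o f : borelRV R d -> \bar R).
  by apply/measurable_EFinP; exact: continuous_measurableRV.
rewrite -(setUv S) ge0_integral_setU//; last 3 first.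
- by rewrite setUv.
- by move=> y _; rewrite lee_fin.
- by apply/disj_setPS; rewrite setICr.
rewrite [X in (_ + X)%E]null_set_integral//; last 2 first.
- exact: measurable_funTS.
- exact: suppC_null.
rewrite adde0 /sint /Rintegral fineK//.
exact: integrable_fin_num (cont_integrable cS cf).
Qed.

(** The density of [s Y + N] at [z], up to the Gaussian normalization. *)
Definition umass s z : R := sint u0 (fun y => expR (gexp T z s y)).

Lemma umass_gt0 s z : 0 < umass s z.
Proof. by apply: sint_exp_gt0 => //; exact: cont_gexp. Qed.

(** The value [f (z + h Y)] at [Y = y], weighted by the joint density of
    [s Y + N] and [Y]. *)
Definition coupling s h f z y : R := f (z + h *: y) * expR (gexp T z s y).

Lemma cont_coupling s h f z : continuous f -> continuous (coupling s h f z).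
Proof.
move=> cf; apply: contM; last by apply: cont_expR; exact: cont_gexp.
move=> y; apply: (@continuous_comp _ _ _ (fun y : V => z + h *: y) f);
  last exact: cf.
apply: continuousD; first exact: cst_continuous.
exact: scaler_continuous.
Qed.

Lemma measurable_coupling s h f : continuous f -> measurable_fun setT
  (fun p : borelRV R d * borelRV R d => coupling s h f p.1 p.2).
Proof.
move=> cf; apply: measurable_funM.
  apply: (measurableT_comp (continuous_measurableRV cf)).
  exact: measurable_shift_pair.
apply: measurableT_comp => //.
rewrite (_ : (fun p => _) = (fun w : borelRV R d => gexp T w 0 0) \o
    (fun p : borelRV R d * borelRV R d => (p.1 + (- s) *: p.2 : V)));
      last first.
  by apply/funext => p /=; rewrite /gexp scaler0 subr0 scaleNr.
apply: measurableT_comp (measurable_shift_pair (- s)).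
apply: continuous_measurableRV; apply: contN; apply: contM; last exact: contC.
under eq_fun do rewrite scaler0 subr0 expr2.
by apply: contM; exact: continuous_enorm.
Qed.

Lemma coupling_ge0 s h f z y : (forall z, 0 <= f z) -> 0 <= coupling s h f z y.
Proof. by move=> f0; rewrite mulr_ge0 ?expR_ge0. Qed.

Let mcoup s h f : continuous f -> measurable_fun setT
  (fun p : d.-tuple mR * borelRV R d => (coupling s h f (row_of_tuple p.1)
    p.2)%:E).
Proof.
move=> cf; apply/measurable_EFinP.
apply: (measurableT_comp (measurable_coupling s h cf)
  (g := fun p : d.-tuple mR * borelRV R d => (row_of_tuple p.1, p.2))).
apply/measurable_fun_pairP; split.
  by apply: (measurableT_comp (f := @row_of_tuple R d)) => //;
    exact: measurable_fst.
exact: measurable_snd.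
Qed.

Lemma measurable_sint_coupling s h f : continuous f -> (forall z, 0 <= f z) ->
  measurable_fun setT (fun t => (sint u0 (coupling s h f (row_of_tuple t)))%:E).
Proof.
move=> cf f0; under eq_fun => t.
  rewrite -sint_integral; [|exact: cont_coupling|by move=> y;
    exact: coupling_ge0].
  over.
apply: (measurable_fun_fubini_tonelli_F (m2 := u0)
  (fun p => (coupling s h f (row_of_tuple p.1) p.2)%:E)); first exact: mcoup.
by move=> p; rewrite lee_fin coupling_ge0.
Qed.

(** If [z] has the law of [s Y + N] jointly with [Y], then [z + h Y] has the
    law of [(s + h) Y + N]; here [N] is the unnormalized Gaussian. *)
Lemma integral_coupling s h f : continuous f -> (forall z, 0 <= f z) ->
  (\int[lam]_t (sint u0 (coupling s h f (row_of_tuple t)))%:E =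
   \int[lam]_t (sint u0 (coupling (s + h) 0 f (row_of_tuple t)))%:E)%E.
Proof.
move=> cf f0.
have swap a b : (\int[lam]_t (sint u0 (coupling a b f (row_of_tuple t)))%:E =
    \int[u0]_y \int[lam]_t (coupling a b f (row_of_tuple t) y)%:E)%E.
  under eq_integral => t _.
    rewrite -sint_integral; [|exact: cont_coupling|by move=> y;
      exact: coupling_ge0].
    over.
  apply: (@fubini_tonelli _ _ _ _ _ lam u0
    (fun p => (coupling a b f (row_of_tuple p.1) p.2)%:E)); first exact: mcoup.
  by move=> p; rewrite lee_fin coupling_ge0.
apply: etrans (swap s h) _; apply: etrans _ (esym (swap (s + h) 0)).
apply: eq_integral => y _.
pose H t := (coupling (s + h) 0 f (row_of_tuple t) y)%:E.
pose hy : d.-tuple mR := [tuple h * (y : V) ord0 i | i < d].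
transitivity (\int[lam]_t H (tuple_translate hy t))%E.
  apply: eq_integral => t _; rewrite /H row_of_tuple_translate /coupling.
  by rewrite scale0r addr0 gexp_translate.
apply: integral_tuple_translate => [|t]; last by rewrite lee_fin coupling_ge0.
exact: (measurable_fun_pair1 y (mcoup (s + h) 0 cf)).
Qed.

Lemma sint_coupling0 s f z : sint u0 (coupling s 0 f z) = f z * umass s z.
Proof.
rewrite /umass -sintZ//; last by apply: cont_expR; exact: cont_gexp.
by apply: eq_sint => y _; rewrite /coupling scale0r addr0.
Qed.

Lemma measurable_umass s :
  measurable_fun setT (fun z : borelRV R d => (umass s z)%:E).
Proof.
have c1 : continuous (fun _ : V => 1 : R) by exact: contC.
have E z : (umass s z)%:E = (\int[u0]_y (coupling s 0 (fun=> 1) z y)%:E)%E.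
  rewrite sint_integral; [|exact: cont_coupling|by move=> y;
    exact: coupling_ge0].
  by rewrite sint_coupling0 mul1r.
under eq_fun => z do rewrite E.
apply: (measurable_fun_fubini_tonelli_F (m2 := u0)
  (fun p : borelRV R d * borelRV R d => (coupling s 0 (fun=> 1) p.1 p.2)%:E)).
  by apply/measurable_EFinP; exact: measurable_coupling.
by move=> p; rewrite lee_fin coupling_ge0.
Qed.

End joint_law.

(** * One Euler step *)

Section transport.
Context {R : realType} {d : nat} (u0 : probability (borelRV R d) R) (T : R).
Hypotheses (T0 : 0 < T) (cS : compact (supp u0)).
Local Notation mR := (measurableTypeR R).
Local Notation lam := (tuple_measure (@lebesgue_measure R) d).
Local Notation V := 'rV[R]_d.
Local Notation row := (@row_of_tuple R d).
Implicit Types (y z : V) (s h c : R) (f g : V -> R) (t : d.-tuple mR).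
Let S := supp u0.

(** Jensen's inequality for semiconvex functions: the variance of the random
    displacement [h Y] is of order [h ^ 2]. *)
Lemma semiconvex_jensen B c g s h z : 0 <= B -> (forall y,
  S y -> enorm y <= B) ->
  0 <= c -> semiconvex c g ->
  g (euler u0 T h s z) * umass u0 T s z <=
  sint u0 (coupling T s h g z) + c * h ^+ 2 * (4 * B ^+ 2) * umass u0 T s z.
Proof.
move=> B0 SB c0 gc; have cg := semiconvex_continuous c0 gc.
have ce : continuous (gexp T z s) by exact: cont_gexp.
have U0 : 0 < umass u0 T s z by exact: umass_gt0.
have cgz : continuous (fun y : V => g (z + h *: y)).
  move=> y; apply: (@continuous_comp _ _ _ (fun y : V => z + h *: y) g);
    last exact: cg.
  by apply: continuousD; [exact: cst_continuous|exact: scaler_continuous].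
have -> : sint u0 (coupling T s h g z) =
    avg u0 (gexp T z s) (fun y => g (z + h *: y)) * umass u0 T s z.
  by rewrite /avg divfK// gt_eqF.
rewrite -mulrDl ler_pM2r//; apply/ler_addgt0Pr => eta eta0.
set m := pmean u0 T z s.
have mB : enorm m <= B by exact: enorm_pmean.
have [p _ gp] := gc (euler u0 T h s z) eta eta0.
pose k := g (euler u0 T h s z) - c * h ^+ 2 * (4 * B ^+ 2) - eta.
suff : k <= avg u0 (gexp T z s) (fun y => g (z + h *: y)) by rewrite /k; lra.
have cl : continuous (fun y : V => h * (dot p y - dot p m)).
  by apply: contM; [exact: contC|apply: contB;
    [exact: continuous_dotr|exact: contC]].
have <- : avg u0 (gexp T z s) (fun y => k + h * (dot p y - dot p m)) = k.
  rewrite avgD//; last exact: contC.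
  rewrite avg_cst// avgZ//; last by apply: contB;
    [exact: continuous_dotr|exact: contC].
  rewrite avgB//; [|exact: continuous_dotr|exact: contC].
  by rewrite avg_cst// -dot_pmean// -/m subrr mulr0 addr0.
apply: avg_le => //; first by apply: contD cl; exact: contC.
move=> y Sy; have := gp (h *: (y - m)).
rewrite (_ : euler u0 T h s z + h *: (y - m) = z + h *: y); last first.
  by rewrite /euler -addrA -scalerDr subrKC.
apply: le_trans; rewrite enormZ exprMn real_normK ?num_real// !dotE /k.
have : c * (h ^+ 2 * enorm (y - m) ^+ 2) <= c * h ^+ 2 * (4 * B ^+ 2).
  rewrite mulrA; apply: ler_wpM2l; first by rewrite mulr_ge0 ?sqr_ge0.
  rewrite (_ : 4 * B ^+ 2 = (2 * B) ^+ 2); last by ring.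
  rewrite ler_pXn2r ?nnegrE ?enorm_ge0 ?mulr_ge0//.
  by apply: le_trans (enormD _ _) _; rewrite enormN; have := SB _ Sy; lra.
lra.
Qed.

Let cont1 : continuous (fun _ : V => 1 : R). Proof. exact: contC. Qed.

Lemma measurable_rowE (F : borelRV R d -> \bar R) :
  measurable_fun setT F ->
  measurable_fun setT (fun t => F (row t)).
Proof. by move=> mF; exact: (measurableT_comp mF (g := row)). Qed.

Lemma measurable_massM g s : continuous g ->
  measurable_fun setT (fun z : borelRV R d => (g z * umass u0 T s z)%:E).
Proof.
move=> cg; apply/measurable_EFinP; apply: measurable_funM.
  exact: continuous_measurableRV.
by apply/measurable_EFinP; exact: measurable_umass.
Qed.

Definition gmass (k : R) : \bar R :=
  (\int[lam]_t (expR (- (k * enorm (row t) ^+ 2)))%:E)%E.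

Lemma measurable_gauss k :
  measurable_fun setT (fun t => (expR (- (k * enorm (row t) ^+ 2)))%:E).
Proof.
apply: (@measurable_rowE (fun z => (expR (- (k * enorm z ^+ 2)))%:E)).
apply/measurable_EFinP; apply: continuous_measurableRV; apply: cont_expR.
apply: contN; apply: contM; first exact: contC.
under eq_fun do rewrite expr2.
by apply: contM; exact: continuous_enorm.
Qed.

Lemma gmass_lty k : 0 < k -> (gmass k < +oo)%E.
Proof.
move=> k0; apply: le_lt_trans (gauss_tuple_lty d k0).
rewrite /gmass le_eqVlt; apply/orP; left; apply/eqP; apply: eq_integral => t _.
congr (expR (- (k * _)))%:E; rewrite enorm_sqr; apply: eq_bigr => i _.
by rewrite mxE expr2.
Qed.

Lemma gmass_ge0 k : (0 <= gmass k)%E.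
Proof. by apply: integral_ge0 => t _; rewrite lee_fin expR_ge0. Qed.

Lemma gexp0 z y : gexp T z 0 y = - ((4 * T)^-1 * enorm z ^+ 2).
Proof. by rewrite /gexp scale0r subr0 mulrC. Qed.

Lemma integral_umass s :
  (\int[lam]_t (umass u0 T s (row t))%:E = gmass (4 * T)^-1)%E.
Proof.
have E a b z : coupling T a b (fun=> 1) z = fun y => expR (gexp T z a y).
  by apply/funext => y; rewrite /coupling mul1r.
have := integral_coupling T cS s (- s) cont1 (fun=> ler01).
rewrite subrr => I.
transitivity (\int[lam]_t (sint u0 (coupling T s (- s) (fun=> 1) (row
  t)))%:E)%E.
  by apply: eq_integral => t _; rewrite E.
rewrite I; apply: eq_integral => t _; rewrite E.
congr EFin; rewrite -[RHS](sint_cst u0); apply: eq_sint => y _.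
by rewrite gexp0.
Qed.

Lemma euler_step_integral B c g s h : 0 <= B -> (forall y,
  S y -> enorm y <= B) ->
  0 <= c -> semiconvex c g -> (forall z, 0 <= g z) ->
  continuous (g \o euler u0 T h s) ->
  (\int[lam]_t (g (euler u0 T h s (row t)) * umass u0 T s (row t))%:E <=
   \int[lam]_t (g (row t) * umass u0 T (s + h) (row t))%:E +
   (c * h ^+ 2 * (4 * B ^+ 2))%:E * gmass (4 * T)^-1)%E.
Proof.
move=> B0 SB c0 gc g0 cge; have cg := semiconvex_continuous c0 gc.
have k0 : 0 <= c * h ^+ 2 * (4 * B ^+ 2) by apply: mulr_ge0 (mulr_ge0 c0
  (sqr_ge0 h)) (mulr_ge0 _ (sqr_ge0 B)).
have mU r : measurable_fun setT (fun t => (umass u0 T r (row t))%:E).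
  by apply: (@measurable_rowE (fun z => (umass u0 T r z)%:E));
    exact: measurable_umass.
have mC : measurable_fun setT (fun t => (sint u0 (coupling T s h g (row
  t)))%:E).
  exact: measurable_sint_coupling.
have C0 t : (0 <= (sint u0 (coupling T s h g (row t)))%:E)%E.
  rewrite lee_fin -[leLHS](sint_cst u0); apply: sint_le => //;
    [exact: contC|exact: cont_coupling|].
  by move=> y _; exact: coupling_ge0.
set I1 := (X in (_ <= X + _)%E).
have <- : (\int[lam]_t (sint u0 (coupling T s h g (row t)))%:E = I1)%E.
  apply: etrans (integral_coupling T cS s h cg g0) _; apply: eq_integral => t _.
  by rewrite sint_coupling0.
rewrite -(integral_umass s); set K := (c * h ^+ 2 * _)%:E.
rewrite -ge0_integralZl//; last first.
  by move=> t _; rewrite lee_fin ltW// umass_gt0.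
rewrite -ge0_integralD//; last 2 first.
- by move=> t _; rewrite mule_ge0// lee_fin ltW// umass_gt0.
- exact: measurable_funeM.
apply: ge0_le_integral => //.
- by move=> t _; rewrite lee_fin mulr_ge0// ltW// umass_gt0.
- apply: (@measurable_rowE (fun z => (g (euler u0 T h s z) * umass u0 T s
  z)%:E)).
  exact: (@measurable_massM (g \o euler u0 T h s)).
- by apply: emeasurable_funD => //; exact: measurable_funeM.
by move=> t _; rewrite -EFinM -EFinD lee_fin; exact: semiconvex_jensen.
Qed.

End transport.

(** * The limit of the Euler scheme *)

Section almost_everywhere.
Context {R : realType} {d : nat} (u0 : probability (borelRV R d) R) (T : R).
Hypotheses (T0 : 0 < T) (cS : compact (supp u0)).
Local Notation mR := (measurableTypeR R).
Local Notation lam := (tuple_measure (@lebesgue_measure R) d).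
Local Notation V := 'rV[R]_d.
Local Notation row := (@row_of_tuple R d).
Implicit Types (y z : V) (s h c : R) (f g : V -> R) (t : d.-tuple mR).
Let S := supp u0.

Lemma euler_steps_semiconvex Sg : 0 <= Sg -> exists2 K, 0 <= K &
  forall h m s c g, 0 <= h <= 1 -> 0 <= s -> s + m%:R * h <= Sg -> 0 <= c ->
    semiconvex c g -> semiconvex (c * (1 + K * h) ^+ m) (g \o euler_steps u0 T
      h m s).
Proof.
move=> /(euler_semiconvex T0 cS)[K K0 HK]; exists K => // h m.
elim: m => [|m IH] s c g hh s0 sS c0 gc; first by rewrite expr0 mulr1.
have /andP[h0 h1] := hh.
have mh : 0 <= m%:R * h by rewrite mulr_ge0.
have sE : s + m.+1%:R * h = s + h + m%:R * h by rewrite -natr1; ring.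
rewrite sE in sS.
have sh0 : 0 <= s + h by rewrite addr_ge0.
have := IH (s + h) c g hh sh0 sS c0 gc.
have c1 : 0 <= c * (1 + K * h) ^+ m.
  by rewrite mulr_ge0// exprn_ge0// addr_ge0// mulr_ge0.
have sS' : 0 <= s <= Sg by apply/andP; split; lra.
by move=> /(HK s h _ _ sS' hh c1); rewrite exprSr mulrA.
Qed.

Lemma semiconvex_le c c' g : c <= c' -> semiconvex c g -> semiconvex c' g.
Proof.
move=> cc' gc x eta eta0; have [p pc gp] := gc x eta eta0.
exists p => [|a]; first exact: le_trans cc'.
apply: le_trans (gp a); rewrite lerD2r lerD2l lerN2.
by rewrite ler_wpM2r ?sqr_ge0.
Qed.

Local Notation jint g s := (\int[lam]_t (g (row t) * umass u0 T s (row
  t))%:E)%E.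

Lemma euler_steps_integral Sg c g : 1 <= Sg -> 0 <= c -> semiconvex c g ->
  (forall z, 0 <= g z) -> exists2 D, 0 <= D & forall n,
    (0 < n)%N -> Sg - 1 <= n%:R ->
  continuous (g \o euler_steps u0 T ((Sg - 1) / n%:R) n 1) /\
  (jint (g \o euler_steps u0 T ((Sg - 1) / n%:R) n 1) 1 <=
   jint g Sg + (D / n%:R)%:E * @gmass R d (4 * T)^-1)%E.
Proof.
move=> Sg1 c0 gc g0; have [B B1 SB] := supp_bounded cS.
have B0 : 0 <= B by exact: le_trans B1.
have Sg0 : 0 <= Sg by exact: le_trans Sg1.
have [K K0 HK] := euler_steps_semiconvex Sg0.
pose C := c * expR (K * Sg).
have C0 : 0 <= C by rewrite mulr_ge0 ?expR_ge0.
pose E := C * (4 * B ^+ 2).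
have E0 : 0 <= E by rewrite mulr_ge0// mulr_ge0// sqr_ge0.
have key h m s : 0 <= h <= 1 -> 0 <= s -> s + m%:R * h <= Sg ->
    semiconvex C (g \o euler_steps u0 T h m s) /\
    (jint (g \o euler_steps u0 T h m s) s <= jint g (s + m%:R * h)%R +
     (m%:R * (E * h ^+ 2))%:E * @gmass R d (4 * T)^-1)%E.
  elim: m s => [|m IH] s hh s0 sS.
    split; last by rewrite !mul0r mul0e adde0 addr0.
    apply: semiconvex_le gc; rewrite /C -[leLHS]mulr1 ler_wpM2l//.
    by rewrite -expR0 ler_expR mulr_ge0.
  have /andP[h0 h1] := hh.
  have mh : 0 <= m%:R * h by rewrite mulr_ge0.
  have scm : semiconvex C (g \o euler_steps u0 T h m.+1 s).
    apply: semiconvex_le (HK h m.+1 s c g hh s0 sS c0 gc).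
    rewrite ler_wpM2l//; apply: le_trans (exprn_le_expR _ (mulr_ge0 K0 h0)) _.
    rewrite ler_expR mulrCA ler_wpM2l//; lra.
  split=> //.
  have sE : s + m.+1%:R * h = s + h + m%:R * h by rewrite -natr1; ring.
  rewrite sE in sS *.
  have sh0 : 0 <= s + h by rewrite addr_ge0.
  have [sc IHm] := IH (s + h) hh sh0 sS.
  have g0' z : 0 <= (g \o euler_steps u0 T h m (s + h)) z by exact: g0.
  have cge : continuous ((g \o euler_steps u0 T h m (s + h)) \o euler u0 T h s).
    exact: semiconvex_continuous C0 scm.
  have step := euler_step_integral cS B0 SB C0 sc g0' cge.
  apply: (le_trans step) => {step}.
  rewrite (_ : (m.+1%:R * (E * h ^+ 2))%:E =
    (m%:R * (E * h ^+ 2))%:E + (C * h ^+ 2 * (4 * B ^+ 2))%:E)%E; last first.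
    by rewrite -EFinD /E -natr1; congr EFin; ring.
  rewrite ge0_muleDl ?lee_fin; last 2 first.
  - by rewrite mulr_ge0// mulr_ge0// sqr_ge0.
  - by apply: mulr_ge0 (mulr_ge0 C0 (sqr_ge0 h)) (mulr_ge0 _ (sqr_ge0 B)).
  by rewrite [X in (_ <= X)%E]addeA; exact: leeD2r IHm.
exists (E * (Sg - 1) ^+ 2); first by apply: mulr_ge0 E0 (sqr_ge0 _).
move=> n n0 nS; have nR : 0 < n%:R :> R by rewrite ltr0n.
set h := (Sg - 1) / n%:R.
have hh : 0 <= h <= 1.
  by rewrite divr_ge0 ?subr_ge0// ler_pdivrMr// mul1r.
have nh : n%:R * h = Sg - 1 by rewrite mulrC divfK// gt_eqF.
have SE : 1 + n%:R * h = Sg by rewrite nh subrKC.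
have := key h n 1 hh ler01; rewrite SE => /(_ (lexx _))[sc le].
split; first exact: semiconvex_continuous C0 sc.
apply: le_trans le _; rewrite (_ : n%:R * _ = E * (Sg - 1) ^+ 2 / n%:R)//.
by rewrite /h; field; rewrite gt_eqF.
Qed.

(** With [n + k.+1] steps the step size is at most 1. *)
Definition approx (k n : nat) z : V :=
  euler_steps u0 T ((k%:R - 1) / (n + k.+1)%:R) (n + k.+1) 1 z.

Lemma limn_einf_le (u : nat -> \bar R) (a : \bar R) (D : R) (b : \bar R) : 0 <=
  D ->
  (0 <= b)%E -> (b < +oo)%E -> forall k,
  (forall n, u n <= a + (D / (n + k.+1)%:R)%:E * b)%E -> (limn_einf u <= a)%E.
Proof.
move=> D0 b0 boo k ub; apply/lee_addgt0Pr => e e0.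
have [N NP] : exists N, forall n, (N <= n)%N -> (u n <= a + e%:E)%E.
  pose r := fine b; have bE : b = r%:E by rewrite fineK// ge0_fin_numE.
  have r0 : 0 <= r by rewrite fine_ge0.
  have x0 : 0 <= D * r / e by rewrite divr_ge0 ?mulr_ge0// ltW.
  exists (Num.truncn (D * r / e)).+1 => n nN; apply: le_trans (ub n) _.
  rewrite leeD2l// bE -EFinM lee_fin mulrAC ler_pdivrMr; last first.
    by rewrite ltr0n addnS.
  rewrite -ler_pdivrMl// mulrC; apply: le_trans (ltW (truncnS_gt _)) _.
  by rewrite ler_nat (leq_trans nN)// leq_addr.
rewrite limn_einf_lim; apply: lime_le; first exact: is_cvg_einfs.
apply: nearW => n; apply: (@le_trans _ _ (u (maxn n N))).
  by apply: ereal_inf_lbound; exists (maxn n N) => //=; rewrite leq_maxl.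
by apply: NP; rewrite leq_maxr.
Qed.

Lemma measurable_limn_einf (F : nat -> borelRV R d -> \bar R) :
  (forall n, measurable_fun setT (F n)) ->
  measurable_fun setT (fun z : borelRV R d => limn_einf (F ^~ z)).
Proof.
move=> mF; rewrite /limn_einf.
apply: (measurableT_comp (f := -%E)) => //.
have mNF n : measurable_fun setT (fun z : borelRV R d => - F n z)%E.
  exact: measurableT_comp.
exact: (measurable_fun_limn_esup mNF).
Qed.

(** A limit inferior, because the scheme is known to converge only where a
    solution passes. *)
Definition limit_mass k g z : \bar R :=
  limn_einf (fun n => (g (approx k n z) * umass u0 T 1 z)%:E).

Lemma limit_mass_ge0 k g z : (forall z, 0 <= g z) -> (0 <= limit_mass k g z)%E.
Proof.
move=> g0; rewrite /limit_mass limn_einf_lim; apply: lime_ge;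
  first exact: is_cvg_einfs.
apply: nearW => n; apply: le_ereal_inf_tmp => _ [m _ <-].
by rewrite lee_fin mulr_ge0// ltW// umass_gt0.
Qed.

(** By Fatou's lemma, the integral of [g] for the law at scale [k] dominates
    its integral along the limit of the Euler maps for the law at scale 1. *)
Lemma limit_mass_integral k c g : (0 < k)%N -> 0 <= c -> semiconvex c g ->
  (forall z, 0 <= g z) ->
  measurable_fun setT (limit_mass k g : borelRV R d -> \bar R) /\
  (\int[lam]_t limit_mass k g (row t) <= jint g k%:R)%E.
Proof.
move=> k0 c0 gc g0; have k1 : 1 <= k%:R :> R by rewrite ler1n.
have [D D0 HD] := euler_steps_integral k1 c0 gc g0.
have nk n : (0 < n + k.+1)%N by rewrite addnS.
have kn n : k%:R - 1 <= (n + k.+1)%:R :> R.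
  rewrite natrD -natr1; have : 0 <= n%:R :> R by []; lra.
have mF n : measurable_fun setT
    (fun z : borelRV R d => (g (approx k n z) * umass u0 T 1 z)%:E).
  have [cn _] := HD _ (nk n) (kn n).
  exact: (measurable_massM T cS 1 cn).
split; first exact: measurable_limn_einf.
apply: le_trans (fatou _ _ _ _) _ => //.
- by move=> n; apply: (measurable_rowE (mF n)).
- by move=> n t _; rewrite lee_fin mulr_ge0// ltW// umass_gt0.
have k4 : 0 < (4 * T)^-1 by rewrite invr_gt0 mulr_gt0.
apply: (limn_einf_le D0 (@gmass_ge0 R d _) (@gmass_lty R d _ k4) (k := k)) => n.
by have [_] := HD _ (nk n) (kn n).
Qed.

End almost_everywhere.

(** * Almost every solution approaches the support *)

Section bad_set.
Context {R : realType} {d : nat} (u0 : probability (borelRV R d) R) (T : R).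
Hypotheses (T0 : 0 < T) (cS : compact (supp u0)).
Local Notation mR := (measurableTypeR R).
Local Notation lam := (tuple_measure (@lebesgue_measure R) d).
Local Notation V := 'rV[R]_d.
Local Notation row := (@row_of_tuple R d).
Implicit Types (y z : V) (s h c : R) (f g : V -> R) (t : d.-tuple mR).
Let S := supp u0.

Definition far_set (eps s : R) : set V :=
  [set z | forall y, S y -> eps * s <= enorm (z - s *: y)].

Definition far_bump (eps s : R) : V -> R := bump (far_set eps s) (eps * s / 2).

(** At scale [s] the law is that of [s Y + N] with [N] Gaussian, so mass away
    from [s S] lives in the Gaussian tail. *)
Lemma far_bump_mass eps s : 0 < eps -> 0 < s ->
  (\int[lam]_t (far_bump eps s (row t) * umass u0 T s (row t))%:E <=
   (expR (- ((eps * s) ^+ 2 / (32 * T))))%:E * @gmass R d (8 * T)^-1)%E.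
Proof.
move=> e0 s0; have es : 0 < eps * s by exact: mulr_gt0.
have r0 : 0 < eps * s / 2 by rewrite divr_gt0.
set g := far_bump eps s.
have g0 z : 0 <= g z by exact: bump_ge0.
have cg : continuous g.
  apply: semiconvex_continuous (bump_semiconvex _ r0).
  by rewrite addr_ge0 ?invr_ge0 ?sqr_ge0// divr_ge0// ltW.
set E := expR _; set I := (X in (X <= _)%E).
have <- : (\int[lam]_t (sint u0 (coupling T 0 s g (row t)))%:E = I)%E.
  apply: etrans (integral_coupling T cS 0 s cg g0) _; apply: eq_integral => t _.
  by rewrite add0r sint_coupling0.
have mG : measurable_fun setT (fun t => (expR (- ((8 * T)^-1 * enorm (row t) ^+
  2)))%:E).
  exact: measurable_gauss.
rewrite -ge0_integralZl//; last by rewrite lee_fin expR_ge0.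
apply: ge0_le_integral => //.
- move=> t _; rewrite lee_fin -[leLHS](sint_cst u0); apply: sint_le => //;
    [exact: contC|exact: cont_coupling|].
  by move=> y _; exact: coupling_ge0.
- exact: measurable_sint_coupling.
- exact: measurable_funeM.
move=> t _; rewrite -EFinM lee_fin; set z := row t.
rewrite -[leRHS](sint_cst u0); apply: sint_le => //;
  [exact: cont_coupling|exact: contC|].
move=> y Sy; rewrite /coupling gexp0.
have [zr|zr] := ltP (enorm z) (eps * s / 2).
  rewrite (_ : g _ = 0) ?mul0r ?mulr_ge0 ?expR_ge0//.
  apply: bump_eq0 => // w /(_ y Sy) h1; rewrite enormB in h1.
  have := enorm_triangle (z + s *: y) (s *: y) w.
  rewrite (_ : s *: y - (z + s *: y) = - z) ?enormN; first by lra.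
  by rewrite opprD addrCA subrr addr0.
apply: (@le_trans _ _ (1 * expR (- ((4 * T)^-1 * enorm z ^+ 2)))).
  by rewrite ler_wpM2r ?expR_ge0// bump_le1.
rewrite mul1r /E -expRD ler_expR -opprD lerN2.
have -> : (eps * s) ^+ 2 / (32 * T) = (8 * T)^-1 * (eps * s / 2) ^+ 2.
  by field; rewrite gt_eqF.
have -> : (4 * T)^-1 * enorm z ^+ 2 =
    (8 * T)^-1 * enorm z ^+ 2 + (8 * T)^-1 * enorm z ^+ 2.
  by field; rewrite gt_eqF.
rewrite lerD2r ler_wpM2l ?invr_ge0 ?mulr_ge0 ?(ltW T0)//.
by rewrite ler_pXn2r ?nnegrE ?enorm_ge0 ?(ltW r0).
Qed.

Lemma far_limit_mass eps k xT Z : 0 < eps -> (0 < k)%N ->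
  rescaled_solution u0 T xT Z -> far_set eps k%:R (Z k%:R) ->
  limit_mass u0 T k (far_bump eps k%:R) xT = (umass u0 T 1 xT)%:E.
Proof.
move=> e0 k0 sol far; have k1 : 1 <= k%:R :> R by rewrite ler1n.
have r0 : 0 < eps * k%:R / 2 by rewrite divr_gt0// mulr_gt0// ltr0n.
set g := far_bump eps k%:R.
have [C C0 HC] := euler_cvg T0 cS sol k1.
set c := 2 / (eps * k%:R / 2) + (eps * k%:R / 2) ^- 2.
have c0 : 0 <= c by rewrite addr_ge0 ?invr_ge0 ?sqr_ge0// divr_ge0// ltW.
have gc : semiconvex c g by exact: bump_semiconvex.
have gZ : g (Z k%:R) = 1 by exact: bump_eq1.
have U0 : 0 < umass u0 T 1 xT by exact: umass_gt0.
suff cv : (fun n => (g (approx u0 T k n xT) * umass u0 T 1 xT)%:E) @ \oo -->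
    (umass u0 T 1 xT)%:E by have [] := cvg_limn_einf_sup cv.
apply/cvg_EFin; first by apply: nearW.
rewrite -[X in _ --> X]mul1r; apply: cvgM; last exact: cvg_cst.
apply/(@cvgrPdist_lt _ R^o) => e ep.
near=> n.
have nR : 0 < (n + k.+1)%:R :> R by rewrite ltr0n addnS.
have nC : C + 2 * c * C / e < (n + k.+1)%:R.
  apply: (@lt_le_trans _ _ n%:R); first by near: n; exact: nbhs_infty_gtr.
  by rewrite ler_nat leq_addr.
have := HC (n + k.+1)%N; rewrite addnS => /(_ isT); rewrite -addnS.
rewrite -/(approx u0 T k n xT); set a := _ - _ => aC.
have x0 : 0 <= 2 * c * C / e by rewrite divr_ge0 ?mulr_ge0// ltW.
have a1 : enorm a <= 1.
  by apply: le_trans aC _; rewrite ler_pdivrMr// mul1r; lra.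
have := semiconvex_lip (Z k%:R) c0 gc a1; rewrite /a subrKC gZ distrC => h1.
apply: le_lt_trans h1 _;
  apply: (@le_lt_trans _ _ (2 * c * (C / (n + k.+1)%:R))).
  by rewrite ler_wpM2l// mulr_ge0.
rewrite mulrA ltr_pdivrMr// -ltr_pdivrMl// mulrC; lra.
Unshelve. all: by end_near. Qed.

Lemma row_null (N : set (borelRV R d)) : measurable N ->
  (\int[lam]_(t in row @^-1` N) (umass u0 T 1 (row t))%:E = 0)%E ->
  (@lebesgue_measureRV R d).-negligible N.
Proof.
move=> mN I0; exists N; split => //.
have mrN : measurable (row @^-1` N).
  by rewrite -[X in measurable X]setTI; apply: measurable_funPT.
have mU : measurable_fun (row @^-1` N) (fun t => (umass u0 T 1 (row t))%:E).
  apply: measurable_funTS; apply: (measurable_rowE (measurable_umass T cS 1)).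
have : ae_eq lam (row @^-1` N) (fun t => (umass u0 T 1 (row t))%:E) (cst 0%E).
  apply/(ae_eq_integral_abs lam mrN mU); rewrite -[RHS]I0.
  by apply: eq_integral => t _; rewrite gee0_abs// lee_fin ltW// umass_gt0.
move=> H; apply: (measure_negligible mrN).
apply: negligibleS H => t Nt /= /(_ Nt) [U0].
by have := umass_gt0 T cS 1 (row t); rewrite U0 ltxx.
Qed.

(** On the bad set the limit mass is, for every large [k], the full mass at
    scale 1, yet its integral is at most a Gaussian tail that vanishes as [k]
    grows.  Since the mass is positive everywhere, the bad set is null. *)
Lemma bad_set_negligible eps m : 0 < eps ->
  (@lebesgue_measureRV R d).-negligible [set xT : V | exists2 Z,
    rescaled_solution u0 T xT Z & forall k,
      (m < k)%N -> far_set eps k%:R (Z k%:R)].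
Proof.
move=> e0.
pose F k (z : borelRV R d) : \bar R := limit_mass u0 T k (far_bump eps k%:R) z.
have HF k : (0 < k)%N -> measurable_fun setT (F k) /\
  (\int[lam]_t F k (row t) <= (expR (- ((eps * k%:R) ^+ 2 / (32 * T))))%:E *
    @gmass R d (8 * T)^-1)%E.
  move=> k0; have kR : 0 < k%:R :> R by rewrite ltr0n.
  have r0 : 0 < eps * k%:R / 2 by rewrite divr_gt0// mulr_gt0.
  have c0 : 0 <= 2 / (eps * k%:R / 2) + (eps * k%:R / 2) ^- 2.
    by rewrite addr_ge0 ?invr_ge0 ?sqr_ge0// divr_ge0// ltW.
  have [mF le] := limit_mass_integral T0 cS k0 c0
    (bump_semiconvex (far_set eps k%:R) r0) (bump_ge0 _ _).
  by split=> //; apply: le_trans le (far_bump_mass e0 kR).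
pose Nk n : set (borelRV R d) :=
  [set z | ((umass u0 T 1 z)%:E <= F (n + m.+1)%N z)%E].
have nm n : (0 < n + m.+1)%N by rewrite addnS.
have mNk n : measurable (Nk n).
  rewrite -[X in measurable X]setTI; apply: measurable_lee => //.
    exact: measurable_umass.
  by have [] := HF _ (nm n).
pose N := \bigcap_n Nk n.
have mN : measurable N by exact: bigcapT_measurable.
apply: (@negligibleS _ _ _ _ N) => [xT [Z sol far] n _ /=|].
  have nlt : (m < n + m.+1)%N by rewrite addnS ltnS leq_addl.
  by rewrite /Nk /F /= (far_limit_mass e0 (nm n) sol (far _ nlt)).
apply: row_null => //; set I := (X in X = _).
have I0 : (0 <= I)%E by apply: integral_ge0 => t _;
  rewrite lee_fin ltW// umass_gt0.
apply/eqP; rewrite eq_le I0 andbT.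
have k8 : 0 < (8 * T)^-1 by rewrite invr_gt0 mulr_gt0.
pose D := 32 * T / eps ^+ 2.
have D0 : 0 <= D by rewrite divr_ge0 ?sqr_ge0// mulr_ge0// ltW.
have <- : limn_einf (fun _ : nat => I) = I.
  by have [] := cvg_limn_einf_sup (@cvg_cst _ I nat \oo _).
apply: (limn_einf_le D0 (@gmass_ge0 R d _) (@gmass_lty R d _ k8) (k := m)) => n.
rewrite add0e; have [mF le] := HF _ (nm n).
have nR : 1 <= (n + m.+1)%:R :> R by rewrite ler1n.
have mrN : measurable (row @^-1` N).
  by rewrite -[X in measurable X]setTI; apply: measurable_funPT.
have F0 t : (0 <= F (n + m.+1)%N (row t))%E.
  by apply: limit_mass_ge0 => // z; exact: bump_ge0.
apply: (@le_trans _ _ (\int[lam]_(t in row @^-1` N) F (n + m.+1)%N (row t))%E).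
  apply: ge0_le_integral; first exact: mrN.
  - by move=> t _; rewrite lee_fin ltW// umass_gt0.
  - by apply: measurable_funTS;
    apply: (measurable_rowE (measurable_umass T cS 1)).
  - by apply: measurable_funTS; apply: (measurable_rowE mF).
  by move=> t /(_ n Logic.I).
apply: (@le_trans _ _ (\int[lam]_t F (n + m.+1)%N (row t))%E).
  apply: ge0_subset_integral; [exact: mrN|exact: measurableT|
    exact: (measurable_rowE mF)|by move=> t _; exact: F0|exact: subsetT].
apply: le_trans le _; apply: lee_wpmul2r; first exact: gmass_ge0.
rewrite lee_fin expRN; set q := (n + m.+1)%:R in nR *.
have x0 : 0 < (eps * q) ^+ 2 / (32 * T).
  by rewrite divr_gt0 ?exprn_gt0 ?mulr_gt0// (lt_le_trans ltr01).
apply: (@le_trans _ _ ((eps * q) ^+ 2 / (32 * T))^-1).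
  rewrite lef_pV2 ?posrE ?expR_gt0//.
  by apply: le_trans (expR_ge1Dx _); rewrite lerDr.
have q0 : 0 < q by exact: lt_le_trans nR.
have -> : ((eps * q) ^+ 2 / (32 * T))^-1 = D / q ^+ 2.
  by rewrite /D; field; rewrite !gt_eqF.
rewrite ler_wpM2l// lef_pV2 ?posrE ?exprn_gt0//.
by rewrite expr2 ler_peMl// ltW.
Qed.

(** It suffices to consider inverse integers [eps], so the exceptional set is
    a countable union of bad sets. *)
Lemma ae_approach : {ae @lebesgue_measureRV R d, forall xT : V,
  forall Z, rescaled_solution u0 T xT Z -> forall eps m, 0 < eps ->
    exists2 k, (m < k)%N & exists2 y,
      S y & enorm (Z k%:R - k%:R *: y) < eps * k%:R}.
Proof.
have e0 j : 0 < (j.+1%:R)^-1 :> R by rewrite invr_gt0.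
apply: negligibleS (negligible_bigcup (fun j => negligible_bigcup (fun m =>
  bad_set_negligible m (e0 j)))) => xT /= H.
apply: contrapT => nbad; apply: H => Z sol eps m eps0.
apply: contrapT => nk; apply: nbad.
pose j := Num.truncn eps^-1.
have je : (j.+1%:R)^-1 < eps.
  by rewrite invf_plt ?posrE// truncnS_gt.
exists j => //; exists m => //; exists Z => // k mk y Sy.
rewrite leNgt; apply/negP => lt; apply: nk; exists k => //; exists y => //.
apply: lt_le_trans lt _; rewrite ler_wpM2r//; exact: ltW.
Qed.

End bad_set.

(** * Trapping by an isolated atom *)

Section trapping.
Context {R : realType} {d : nat} (u0 : probability (borelRV R d) R) (T : R).
Hypotheses (T0 : 0 < T) (cS : compact (supp u0)).
Local Notation V := 'rV[R]_d.
Implicit Types (xT y z p : V) (s r a b : R) (f : V -> R).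
Let S := supp u0.

Lemma rescaled_unique xT Z Z' s : rescaled_solution u0 T xT Z ->
  rescaled_solution u0 T xT Z' -> 1 <= s -> Z s = Z' s.
Proof.
move=> sol sol' s1; have [C C0 HC] := euler_cvg T0 cS sol s1.
have [C' C'0 HC'] := euler_cvg T0 cS sol' s1.
apply/eqP; rewrite -subr_eq0; apply/eqP; apply: enorm_eq0; apply/eqP.
rewrite eq_le enorm_ge0 andbT; apply/ler_addgt0Pr => e e0; rewrite add0r.
pose n := (Num.truncn ((C + C') / e)).+1.
have nR : 0 < n%:R :> R by rewrite ltr0n.
have h1 := HC n isT; have h2 := HC' n isT.
apply: le_trans (enorm_triangle (euler_steps u0 T ((s - 1) / n%:R) n 1 xT) _ _)
  _.
rewrite enormB; apply: le_trans (lerD h1 h2) _.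
rewrite -mulrDl ler_pdivrMr// -ler_pdivrMl// mulrC.
exact: ltW (truncnS_gt _).
Qed.

Lemma sint_ge_atom f y : continuous f -> (forall x, 0 <= f x) -> S y ->
  f y * fine (u0 [set y]) <= sint u0 f.
Proof.
move=> cf f0 Sy; have my : measurable ([set y] : set (borelRV R d)).
  apply: closed_measurableRV; apply: accessible_closed_set1.
  exact/hausdorff_accessible/norm_hausdorff.
have mS := supp_measurable u0.
have fin : (\int[u0]_(x in S) (f x)%:E)%E \is a fin_num.
  exact: integrable_fin_num (cont_integrable cS cf).
have u1 : u0 [set y] \is a fin_num by exact: fin_num_measure.
rewrite /sint /Rintegral -lee_fin fineK// EFinM fineK//.
have -> : ((f y)%:E * u0 [set y] = \int[u0]_(x in [set y]) (f x)%:E)%E.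
  rewrite -integral_cst//; apply: eq_integral => x.
  by rewrite inE /= => ->.
apply: ge0_subset_integral => //.
- by apply/measurable_EFinP; apply: measurable_funTS;
  exact: continuous_measurableRV.
- by move=> x _; rewrite lee_fin.
- by move=> x ->.
Qed.

(** When [z] lies in the cell of an isolated atom, all other points of the
    support have exponentially small posterior weight. *)
Lemma pmean_near_atom B y r a z s : (forall x, S x -> enorm x <= B) -> S y ->
  0 < r -> (forall x, S x -> x != y -> 4 * r <= enorm (x - y)) ->
  0 < a -> a <= fine (u0 [set y]) -> 0 < s -> enorm (z - s *: y) <= r * s ->
  enorm (pmean u0 T z s - y) <= 2 * B / a * expR (- (2 * r ^+ 2 / T * s ^+ 2)).
Proof.
move=> SB Sy r0 gap a0 au s0 zr.
have B0 : 0 <= B by exact: le_trans (enorm_ge0 _) (SB _ Sy).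
have ce : continuous (gexp T z s) by exact: cont_gexp.
have T4 : 0 < (4 * T)^-1 by rewrite invr_gt0 mulr_gt0.
apply: enorm_le_dual;
  first by rewrite mulr_ge0 ?expR_ge0// divr_ge0 ?mulr_ge0// ltW.
move=> p; rewrite dotC dotDr dotNr dot_pmean//.
have cd : continuous (fun x : V => dot p x - dot p y).
  by apply: contB; [exact: continuous_dotr|exact: contC].
rewrite -[X in _ - X](avg_cst cS (dot p y) ce) -avgB//;
  [|exact: continuous_dotr|exact: contC].
rewrite /avg ler_pdivrMr ?sint_exp_gt0//.
pose E9 := expR (- (9 * r ^+ 2 * s ^+ 2 / (4 * T))).
pose E1 := expR (- (r ^+ 2 * s ^+ 2 / (4 * T))).
have rs : 0 <= r * s by rewrite ltW// mulr_gt0.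
have num : sint u0 (fun x => (dot p x - dot p y) * expR (gexp T z s x)) <=
    enorm p * (2 * B) * E9.
  rewrite -[leRHS](sint_cst u0); apply: sint_le => //.
  - by apply: contM cd _; exact: cont_expR.
  - exact: contC.
  move=> x Sx; have [->|xy] := eqVneq x y.
    by rewrite subrr mul0r !mulr_ge0 ?expR_ge0 ?enorm_ge0.
  apply: (@le_trans _ _ (enorm p * (2 * B) * expR (gexp T z s x))).
    rewrite ler_wpM2r ?expR_ge0// -dotNr -dotDr; apply: le_trans (dot_le _ _) _.
    rewrite ler_wpM2l ?enorm_ge0//; apply: le_trans (enormD _ _) _.
    by rewrite enormN; have := SB _ Sx; have := SB _ Sy; lra.
  rewrite ler_wpM2l ?mulr_ge0 ?enorm_ge0// ler_expR /gexp lerN2 ler_pM2r//.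
  rewrite (_ : 9 * r ^+ 2 * s ^+ 2 = (3 * (r * s)) ^+ 2); last by ring.
  rewrite ler_pXn2r ?nnegrE ?enorm_ge0//; last by rewrite mulr_ge0.
  have h1 := gap _ Sx xy.
  have h2 : s * (4 * r) <= enorm (s *: x - s *: y).
    by rewrite -scalerBr enormZ gtr0_norm// ler_pM2l.
  have := enorm_triangle z (s *: x) (s *: y); rewrite (enormB (s *: x) z).
  by move: h2 zr; nra.
have den : a * E1 <= sint u0 (fun x => expR (gexp T z s x)).
  have := sint_ge_atom (cont_expR ce) (fun x => expR_ge0 _) Sy.
  apply: le_trans; rewrite mulrC ler_pM ?expR_ge0 ?(ltW a0)//.
  rewrite ler_expR /gexp lerN2 ler_pM2r//.
  by rewrite -exprMn ler_pXn2r ?nnegrE ?enorm_ge0.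
apply: le_trans num _.
have EE : E9 = expR (- (2 * r ^+ 2 / T * s ^+ 2)) * E1.
  by rewrite /E9 /E1 -expRD; congr expR; field; rewrite gt_eqF.
set K := 2 * B / a * expR _ * enorm p.
have K0 : 0 <= K by rewrite mulr_ge0 ?enorm_ge0// mulr_ge0 ?expR_ge0// divr_ge0
  ?mulr_ge0// ltW.
apply: le_trans (ler_wpM2l K0 den); rewrite /K EE le_eqVlt; apply/orP; left;
  apply/eqP.
by field; rewrite gt_eqF.
Qed.

(** A solution entering the inner half of the cell of an atom at a large
    scale stays there, because its relative drift is too slow to leave; the
    drift is integrable, so the offset [Z s - s y] remains bounded. *)
Lemma trapped xT Z B y r a s0 : rescaled_solution u0 T xT Z ->
  0 <= B -> (forall x, S x -> enorm x <= B) -> S y ->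
  0 < r -> (forall x, S x -> x != y -> 4 * r <= enorm (x - y)) ->
  0 < a -> a <= fine (u0 [set y]) -> 1 <= s0 ->
  enorm (Z s0 - s0 *: y) <= r * s0 / 2 ->
  2 * B / a * expR (- (2 * r ^+ 2 / T * s0 ^+ 2)) <= r / 4 ->
  exists2 C, 0 < C & forall s, 1 <= s -> enorm (Z s - s *: y) <= C.
Proof.
move=> sol B0 SB Sy r0 gap a0 au s01 Zs0 small.
pose v s := Z s - s *: y.
have yB : enorm y <= B by exact: SB.
have Ba0 : 0 <= 2 * B / a by rewrite divr_ge0 ?mulr_ge0// ltW.
have vlip b c : 1 <= b -> b <= c -> enorm (v c - v b) <= 2 * B * (c - b).
  move=> b1 bc; have -> : v c - v b = (Z c - Z b) - (c - b) *: y.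
    by rewrite /v scalerBl !opprD !opprK addrACA.
  apply: le_trans (enormD _ _) _; rewrite enormN enormZ ger0_norm ?subr_ge0//.
  have := rescaled_lip cS sol B0 SB b1 bc.
  have : (c - b) * enorm y <= (c - b) * B by rewrite ler_wpM2l// subr_ge0.
  lra.
have drift s : s0 <= s -> enorm (v s) <= r * s ->
    enorm (pmean u0 T (Z s) s - y) <= 2 * B / a * expR (- (2 * r ^+ 2 / T * s
      ^+ 2)).
  move=> ss vs; apply: pmean_near_atom => //.
  by apply: lt_le_trans ss; exact: lt_le_trans s01.
have drift4 s : s0 <= s -> enorm (v s) <= r * s ->
    enorm (pmean u0 T (Z s) s - y) <= r / 4.
  move=> ss vs; apply: le_trans (drift s ss vs) _; apply: le_trans small.
  rewrite ler_wpM2l// ler_expR lerN2 ler_wpM2l//.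
    by rewrite divr_ge0 ?mulr_ge0 ?sqr_ge0// ltW.
  have s00 : 0 <= s0 by lra.
  by rewrite ler_pXn2r ?nnegrE// (le_trans s00).
(* over a length [delta] the offset grows by at most [r / 2] *)
pose delta := r / (4 * B + 1).
have delta0 : 0 < delta by rewrite divr_gt0// ltr_wpDl// mulr_ge0.
have deltaB : 2 * B * delta <= r / 2.
  rewrite /delta mulrA ler_pdivrMr; first by nra.
  by rewrite ltr_wpDl// mulr_ge0.
have inner n s : s0 <= s -> s <= s0 + n%:R * delta -> enorm (v s) <= r * s / 2.
  elim: n s => [|n IH] s ss sn.
    have -> : s = s0 by apply/eqP; rewrite eq_le ss andbT; lra.
    exact: Zs0.
  have outer q : s0 <= q -> q <= s -> enorm (v q) <= r * q.
    move=> s0q qs; have [qn|qn] := lerP q (s0 + n%:R * delta).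
      by apply: le_trans (IH q s0q qn) _; nra.
    pose b := s0 + n%:R * delta.
    have b0 : s0 <= b by rewrite lerDl mulr_ge0// ltW.
    have b1 : 1 <= b by exact: le_trans b0.
    have h1 := IH b b0 (lexx _); have h2 := vlip b q b1 (ltW qn).
    have h3 := enormD (v q - v b) (v b); rewrite subrK in h3.
    have h4 : 2 * B * (q - b) <= 2 * B * delta.
      rewrite ler_wpM2l ?mulr_ge0//; move: sn; rewrite -natr1 mulrDl mul1r /b;
        lra.
    have h5 : r * b <= r * q by rewrite ler_pM2l// ltW.
    have h6 : r <= r * b by rewrite ler_peMr// ltW.
    lra.
  have : enorm (v s - v s0) <= r / 4 * (s - s0).
    apply: enorm_le_dual.
      by apply: mulr_ge0; [rewrite divr_ge0// ltW|rewrite subr_ge0].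
    move=> p; rewrite dotC (_ : v s - v s0 = (Z s - Z s0) - (s - s0) *: y);
      last first.
      by rewrite /v scalerBl !opprD !opprK addrACA.
    have := @rescaled_affine _ _ _ _ xT Z p (dot p y + r / 4 * enorm p) s0 s
      sol s01 ss.
    rewrite !dotDr !dotNr dotZr => h; rewrite lerBlDr; apply: le_trans (h _) _.
      move=> q /andP[q0 qs]; rewrite -lerBlDl -dotNr -dotDr.
      rewrite (le_trans (dot_le _ _))// mulrC ler_wpM2r ?enorm_ge0//.
      by apply: drift4; [exact: ltW|apply: outer; exact: ltW].
    by rewrite le_eqVlt; apply/orP; left; apply/eqP; ring.
  move=> h1; have h3 := enormD (v s - v s0) (v s0); rewrite subrK in h3.
  have h4 : enorm (v s0) <= r * s0 / 2 by [].
  have : 0 <= r * (s - s0) by rewrite mulr_ge0 ?subr_ge0// ltW.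
  lra.
have trap s : s0 <= s -> enorm (v s) <= r * s.
  move=> ss; have sp : 0 <= (s - s0) / delta by rewrite divr_ge0 ?subr_ge0//
    ltW.
  have := inner (Num.truncn ((s - s0) / delta)).+1 s ss.
  have : s <= s0 + (Num.truncn ((s - s0) / delta)).+1%:R * delta.
    by rewrite -lerBlDl -ler_pdivrMr// ltW// truncnS_gt.
  move=> /[swap] /[apply] h; apply: le_trans h _.
  have : 0 <= r * s by rewrite mulr_ge0 ?(ltW r0)//; lra.
  lra.
pose kappa := 2 * r ^+ 2 / T.
have kappa0 : 0 < kappa by rewrite divr_gt0// mulr_gt0// exprn_gt0.
pose A := 2 * B / a.
have far s : s0 <= s -> enorm (v s - v s0) <= A / kappa.
  move=> ss; have Ak : 0 <= A / kappa by rewrite divr_ge0// ltW.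
  apply: enorm_le_dual => // p; rewrite dotC.
  pose K := A / kappa * enorm p.
  have K0 : 0 <= K by rewrite mulr_ge0 ?enorm_ge0.
  (* by [exp (- x) <= 1 / x] the drift is at most the derivative of [- K / q] *)
  pose w (q : R) : R := dot p y * q + K * (- q^-1).
  pose dw (q : R) : R := dot p y + K / q ^+ 2.
  have wd (q : R) : 0 < q -> is_derive q 1 w (dw q).
    move=> q0; have qn : q != 0 by rewrite gt_eqF.
    have d1 := is_deriveZ (dot p y) (is_derive_id q (1 : R)).
    have d2 : is_derive q 1 (fun q : R => q^-1) (- q ^- 2 *: 1).
      by apply: is_deriveV => //; exact: is_derive_id.
    have d3 := is_deriveD d1 (is_deriveZ K (is_deriveN d2)).
    by apply: is_derive_eq d3 _; rewrite /dw /GRing.scale/= !mulr1 opprK.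
  have pos q : s0 <= q -> 0 < q by move=> /(le_trans s01); exact: lt_le_trans.
  have := @rescaled_comparison _ _ _ _ xT Z p s0 s w dw sol s01 ss.
  have -> : v s - v s0 = (Z s - Z s0) - (s - s0) *: y.
    by rewrite /v scalerBl !opprD !opprK addrACA.
  rewrite !dotDr !dotNr dotZr => h.
  rewrite lerBlDr; apply: le_trans (h _ _ _) _.
  - by move=> q /andP[q0 _]; apply: wd; apply: pos; exact: ltW.
  - apply: derivable_within_continuous => q; rewrite in_itv/= => /andP[q0 _].
    by have [] := wd q (pos q q0).
  - move=> q /andP[q0 qs]; have qp := pos q (ltW q0).
    rewrite /dw -lerBlDl -dotNr -dotDr (le_trans (dot_le _ _))//.
    rewrite /K mulrC mulrAC ler_wpM2r ?enorm_ge0//.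
    apply: le_trans (drift q (ltW q0) (trap q (ltW q0))) _.
    have kq : 0 < kappa * q ^+ 2 by rewrite mulr_gt0// exprn_gt0.
    have -> : A / kappa * (q ^+ 2)^-1 = A * (kappa * q ^+ 2)^-1.
      by move: (kappa) kappa0 => k kp; field; rewrite !gt_eqF.
    rewrite -/A -/kappa ler_wpM2l// expRN lef_pV2 ?posrE ?expR_gt0//.
    by apply: le_trans (expR_ge1Dx _); rewrite lerDr.
  rewrite /w; have i0 : 0 < s0^-1 by rewrite invr_gt0 pos.
  have i1 : s0^-1 <= 1 by rewrite invf_le1// pos.
  have i2 : 0 < s^-1 by rewrite invr_gt0 pos.
  rewrite -/K; nra.
exists (enorm (v s0) + A / kappa + 2 * B * (s0 - 1) + 1).
  rewrite ltr_wpDl//; have Ak : 0 <= A / kappa by rewrite divr_ge0// ltW.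
  by rewrite !addr_ge0 ?enorm_ge0// mulr_ge0 ?subr_ge0// mulr_ge0.
move=> s s1; change (enorm (v s) <= enorm (v s0) + A / kappa + 2 * B * (s0 - 1)
  + 1).
have Ak : 0 <= A / kappa by rewrite divr_ge0// ltW.
have Bs : 0 <= 2 * B * (s0 - 1) by rewrite mulr_ge0 ?subr_ge0// mulr_ge0.
have [ss|ss] := lerP s0 s.
  have h := far s ss; have h3 := enormD (v s - v s0) (v s0);
    rewrite subrK in h3.
  lra.
have h := vlip s s0 s1 (ltW ss); rewrite enormB in h.
have h3 := enormD (v s - v s0) (v s0); rewrite subrK in h3.
have : 2 * B * (s0 - s) <= 2 * B * (s0 - 1).
  by rewrite ler_wpM2l ?mulr_ge0// lerD2l lerN2.
lra.
Qed.

End trapping.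

(** * The three statements *)

Section assembly.
Context {R : realType} {d : nat} (u0 : probability (borelRV R d) R) (T : R).
Hypotheses (T0 : 0 < T) (cS : compact (supp u0)).
Local Notation V := 'rV[R]_d.
Implicit Types (xT y z p : V) (s t r : R) (X : R -> V).
Let S := supp u0.

(** The value of [s] corresponding to the time [t]. *)
Definition scale t : R := Num.sqrt T / Num.sqrt t.

Lemma scale_ge1 t : 0 < t <= T -> 1 <= scale t.
Proof.
by move=> /andP[t0 tT];
  rewrite /scale ler_pdivlMr ?sqrtr_gt0// mul1r ler_wsqrtr.
Qed.

Lemma scaleK t : 0 < t -> T / scale t ^+ 2 = t.
Proof.
move=> t0; rewrite /scale expr_div_n !sqr_sqrtr ?ltW//.
by field; rewrite !gt_eqF.
Qed.

Lemma hull_dist xT X t : backward_solution u0 T xT X -> 0 < t <= T ->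
  edist_set (X t) (convex_hull S) <=
  edist_set xT (convex_hull S) * (Num.sqrt T)^-1 * Num.sqrt t.
Proof.
move=> /(rescaled_solutionP T0 cS) sol tT; have /andP[t0 _] := tT.
have s1 := scale_ge1 tT; have s0 : 0 < scale t by exact: lt_le_trans s1.
have := rescaled_hull_dist cS sol s1.
rewrite scalerA mulVf ?gt_eqF// scale1r scaleK// => h.
rewrite -mulrA (_ : (Num.sqrt T)^-1 * Num.sqrt t = (scale t)^-1); last first.
  by rewrite /scale invf_div mulrC.
by rewrite ler_pdivlMr// mulrC.
Qed.

(** The integer scales [k] correspond to the times [T / k ^ 2], which tend
    to 0. *)
Lemma einf_edist_eq0 xT X : backward_solution u0 T xT X ->
  (forall Z, rescaled_solution u0 T xT Z -> forall eps m, 0 < eps ->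
    exists2 k, (m < k)%N & exists2 y,
      S y & enorm (Z k%:R - k%:R *: y) < eps * k%:R) ->
  limf_einf (fun t : R => (edist_set (X t) S)%:E) (0^'+) = 0%E.
Proof.
move=> /(rescaled_solutionP T0 cS) sol /(_ _ sol) near_S.
rewrite limf_einfE; apply/eqP; rewrite eq_le; apply/andP; split; last first.
  apply: le_ereal_sup_tmp;
    exists (ereal_inf [set (edist_set (X t) S)%:E | t in setT]).
    by exists setT => //; exact: filterT.
  by apply: le_ereal_inf_tmp => _ [t _ <-]; rewrite lee_fin edist_set_ge0.
apply: ge_ereal_sup => _ [U U0 <-]; apply/lee_addgt0Pr => e e0; rewrite add0e.
have /nbhs_ballP[delta /= delta0 dU] : nbhs (0 : R) [set t | 0 < t -> U t] by
  exact: U0.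
have [k mk [y Sy]] := near_S e (Num.truncn (T / delta)).+1 e0.
have k0 : 0 < k%:R :> R by rewrite ltr0n (leq_ltn_trans _ mk).
have k1 : 1 <= k%:R :> R by rewrite ler1n -(ltr0n R).
have kT : T / delta < k%:R.
  apply: lt_trans (truncnS_gt _) _; rewrite ltr_nat.
  exact: mk.
rewrite -scalerBr enormZ gtr0_norm// mulrC ltr_pM2r// => Xy.
apply: ge_ereal_inf; exists (edist_set (X (T / k%:R ^+ 2)) S)%:E; last first.
  by rewrite lee_fin (le_trans (edist_set_le _ Sy))// ltW.
have t0 : 0 < T / k%:R ^+ 2 by rewrite divr_gt0// exprn_gt0.
exists (T / k%:R ^+ 2) => //; apply: dU => //.
rewrite -ball_normE /= sub0r normrN gtr0_norm// ltr_pdivrMr ?exprn_gt0//.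
rewrite ltr_pdivrMr// mulrC in kT; apply: lt_le_trans kT _.
by rewrite ler_pM2l// expr2 ler_peMl// ltW.
Qed.

Lemma isolated_gap (A : set V) (N : nat) (y : 'I_N -> V) :
  (forall x, A x -> exists k, x = y k) ->
  exists2 r, 0 < r & forall x x',
    A x -> A x' -> x' != x -> 4 * r <= enorm (x' - x).
Proof.
move=> Ay.
pose F (p : 'I_N * 'I_N) : R := enorm (y p.1 - y p.2) / 4.
pose r := \big[Num.min/(1 : R)]_(p : 'I_N * 'I_N | y p.1 != y p.2) F p.
exists r.
  rewrite /r; apply: (big_ind (fun x => 0 < x)) => [|a b a0 b0|[i j] /= ij].
  - exact: ltr01.
  - by rewrite lt_min a0.
  rewrite divr_gt0// lt_def enorm_ge0 andbT; apply/eqP => /enorm_eq0 h.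
  by move: ij; rewrite -subr_eq0 h eqxx.
move=> x x' /Ay[k ->] /Ay[k' ->] kk.
have h := @bigmin_le_cond _ R _ 1 (k',
  k) (fun p : 'I_N * 'I_N => y p.1 != y p.2) F kk.
have : r <= enorm (y k' - y k) / 4 by exact: h.
lra.
Qed.

(** The offset [Z s - s y] is [X t - y] multiplied by [s = sqrt (T / t)]. *)
Lemma sqrt_rate X y C : 0 < C ->
  (forall s, 1 <= s -> enorm (s *: X (T / s ^+ 2) - s *: y) <= C) ->
  (forall t, 0 < t <= T -> enorm (X t - y) <= C / Num.sqrt T * Num.sqrt t) /\
  X t @[t --> 0^'+] --> y.
Proof.
move=> C0 HC.
have rate t : 0 < t <= T -> enorm (X t - y) <= C / Num.sqrt T * Num.sqrt t.
  move=> tT; have /andP[t0 _] := tT; have s1 := scale_ge1 tT.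
  have s0 : 0 < scale t by exact: lt_le_trans s1.
  have := HC _ s1; rewrite scaleK// -scalerBr enormZ gtr0_norm//.
  rewrite mulrC -ler_pdivlMr// => /le_trans; apply.
  by rewrite /scale invf_div mulrAC mulrA.
split=> // U /nbhs_ballP[e /= e0 eU].
pose r := (e / (C / Num.sqrt T)) ^+ 2.
have c0 : 0 < C / Num.sqrt T by rewrite divr_gt0// sqrtr_gt0.
have r0 : 0 < r by rewrite exprn_gt0// divr_gt0.
change (\forall t \near 0^'+, U (X t)).
near=> t.
have t0 : 0 < t by near: t; exact: nbhs_right_gt.
have tT : t <= T by near: t; exact: nbhs_right_le.
have tr : t < r by near: t; exact: nbhs_right_lt.
apply: eU; rewrite -ball_normE /= distrC;
  apply: le_lt_trans (norm_le_enorm _) _.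
have ttT : 0 < t <= T by rewrite t0.
apply: le_lt_trans (rate _ ttT) _; rewrite mulrC -ltr_pdivlMr//.
rewrite -[ltRHS]ger0_norm; last by rewrite ltW// divr_gt0.
by rewrite -sqrtr_sqr ltr_sqrt.
Unshelve. all: by end_near. Qed.

Section atoms.
Variables (N : nat) (w : 'I_N -> R) (y : 'I_N -> V).
Hypotheses (w0 : forall k, 0 < w k)
  (u0E : forall A : set (borelRV R d), measurable A ->
    u0 A = (\sum_(k < N) (w k)%:E * \d_(y k : borelRV R d) A)%E).

Lemma supp_atoms x : S x -> exists k, x = y k.
Proof.
move=> Sx; apply: contrapT => nx.
have cl : closed (range y).
  apply: (accessible_finite_set_closed.1 _).
    exact/hausdorff_accessible/norm_hausdorff.
  apply: finite_image; exact: finite_finset.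
have oU : open (~` range y) by rewrite openC.
have yx : (~` range y) x by move=> [k _ kx]; apply: nx; exists k.
have := Sx _ oU yx; rewrite u0E; last exact: open_measurableRV.
rewrite big1 ?ltxx// => k _.
by rewrite diracE memNset ?mule0//=; apply; exists k.
Qed.

Lemma atom_mass k : w k <= fine (u0 [set y k]).
Proof.
have my : measurable ([set y k] : set (borelRV R d)).
  apply: closed_measurableRV; apply: accessible_closed_set1.
  exact/hausdorff_accessible/norm_hausdorff.
rewrite -lee_fin fineK; last exact: fin_num_measure.
rewrite u0E// (bigD1 k)//= diracE mem_set// mule1 leeDl//.
by apply: sume_ge0 => i _; rewrite mule_ge0// lee_fin ltW.
Qed.

Lemma atoms_nonempty : exists k : 'I_N, True.
Proof.
by have [x Sx] := supp_nonempty u0; have [k _] := supp_atoms Sx; exists k.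
Qed.

(** The solution comes close to some atom at a scale at which it is trapped.
    The atom and the constant are common to all solutions because solutions
    with the same terminal value coincide. *)
Lemma atoms_trap : {ae @lebesgue_measureRV R d, forall xT : V, exists i,
  exists2 C, 0 < C & forall Z, rescaled_solution u0 T xT Z ->
    forall s, 1 <= s -> enorm (Z s - s *: y i) <= C}.
Proof.
have [B B1 SB] := supp_bounded cS; have B0 : 0 <= B by exact: le_trans B1.
have [r r0 gap] := isolated_gap supp_atoms.
(* a bound common to all atoms, so that the scale at which trapping starts is
   fixed before the atom is known *)
pose a := \big[Num.min/(1 : R)]_k w k.
have a0 : 0 < a.
  rewrite /a; apply: (big_ind (fun x => 0 < x)) => [|b c b0 c0|k _];
    [exact: ltr01| |exact: w0].
  by rewrite lt_min b0.
apply: (negligibleS _ (ae_approach T0 cS)) => xT /= nQ near_S; apply: nQ.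
have [[Z sol]|nsol] := pselect (exists Z, rescaled_solution u0 T xT Z);
  last first.
  have [i _] := atoms_nonempty; exists i; exists 1; first exact: ltr01.
  by move=> Z sol; exfalso; apply: nsol; exists Z.
pose kappa := 2 * r ^+ 2 / T.
have kappa0 : 0 < kappa by rewrite divr_gt0// mulr_gt0// exprn_gt0.
pose A := 2 * B / a.
have A0 : 0 <= A by rewrite divr_ge0 ?mulr_ge0// ltW.
have r2 : 0 < r / 2 by rewrite divr_gt0.
have [k mk [x Sx Zx]] := near_S Z sol (r / 2) (Num.truncn (4 * A / (kappa *
  r))).+1 r2.
have k1 : 1 <= k%:R :> R by rewrite ler1n (leq_ltn_trans _ mk).
have [i xi] := supp_atoms Sx.
have kA : A * expR (- (kappa * k%:R ^+ 2)) <= r / 4.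
  have kk : 4 * A / (kappa * r) < k%:R.
    by apply: lt_trans (truncnS_gt _) _; rewrite ltr_nat.
  have k0 : 0 < k%:R :> R by exact: lt_le_trans k1.
  have kq : 0 < kappa * k%:R by rewrite mulr_gt0.
  apply: (@le_trans _ _ (A * (kappa * k%:R)^-1)).
    rewrite ler_wpM2l// expRN lef_pV2 ?posrE ?expR_gt0//.
    have h := expR_ge1Dx (kappa * k%:R ^+ 2).
    have : kappa * k%:R <= kappa * k%:R ^+ 2 by rewrite ler_pM2l// expr2
      ler_peMl// ltW.
    lra.
  rewrite ler_pdivrMr//; move: kk; rewrite ltr_pdivrMr; last exact: mulr_gt0.
  by move: (A) (kappa) (k%:R : R) => A' kp q h; nra.
have Zi : enorm (Z k%:R - k%:R *: y i) <= r * k%:R / 2 by rewrite -xi mulrAC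
  ltW.
have gapi z : S z -> z != y i -> 4 * r <= enorm (z - y i).
  by move=> Sz; rewrite -xi; exact: gap.
have ai : a <= fine (u0 [set y i]).
  by apply: le_trans (atom_mass i); exact: (@bigmin_le _ R _ 1 i w).
have Si : S (y i) by rewrite -xi.
have [C C0 HC] := trapped T0 cS sol B0 SB Si r0 gapi a0 ai k1 Zi kA.
exists i, C => // Z' sol' s s1.
by rewrite -(rescaled_unique T0 cS sol sol' s1); exact: HC.
Qed.

End atoms.

End assembly.

Theorem theorem3p11 (R : realType) (d : nat) (T : R)
    (u0 : probability (borelRV R d) R) :
  0 < T ->
  compact (supp u0) ->
  [/\ {ae @lebesgue_measureRV R d, forall xT : 'rV[R]_d,
        forall X : R -> 'rV[R]_d, backward_solution u0 T xT X ->
        limf_einf (fun t : R => (edist_set (X t) (supp u0))%:E) (0^'+) = 0%E},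
      (forall (xT : 'rV[R]_d) (X : R -> 'rV[R]_d),
        backward_solution u0 T xT X ->
        forall t : R, 0 < t <= T ->
          edist_set (X t) (convex_hull (supp u0)) <=
          edist_set xT (convex_hull (supp u0)) * (Num.sqrt T)^-1 * Num.sqrt t) &
      (forall (N : nat) (w : 'I_N -> R) (y : 'I_N -> 'rV[R]_d),
        (forall k, 0 < w k) ->
        (forall A : set (borelRV R d), measurable A ->
          u0 A = (\sum_(k < N) (w k)%:E *
                    \d_(y k : borelRV R d) A)%E) ->
        {ae @lebesgue_measureRV R d, forall xT : 'rV[R]_d,
          exists i : 'I_N,
            (forall X : R -> 'rV[R]_d, backward_solution u0 T xT X ->
              X t @[t --> 0^'+] --> y i) /\
            (exists C : R, 0 < C /\
              forall X : R -> 'rV[R]_d, backward_solution u0 T xT X ->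
              forall t : R, 0 < t <= T ->
                enorm (X t - y i) <= C * Num.sqrt t)})].
Proof.
move=> T0 cS; split.
- apply: (negligibleS _ (ae_approach T0 cS)) => xT /= nQ near_S;
  apply: nQ => X sol.
  exact: (einf_edist_eq0 T0 cS sol).
- by move=> xT X sol t tT; exact: hull_dist.
move=> N w y w0 u0E; apply: (negligibleS _ (atoms_trap T0 cS w0 u0E)) => xT /=
  nQ.
move=> [i [C C0 HC]]; apply: nQ.
exists i; split=> [X /(rescaled_solutionP T0 cS) sol|].
  by have [_] := sqrt_rate T0 C0 (HC _ sol).
exists (C / Num.sqrt T); split; first by rewrite divr_gt0// sqrtr_gt0.
move=> X /(rescaled_solutionP T0 cS) sol t tT.
by have [+ _] := sqrt_rate T0 C0 (HC _ sol); apply.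
Qed.
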